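(* Let $\Omega\subset\mathbb{R}^N$ be a bounded domain, $s\in(1/2,1)$, and let $\mathcal{I}$ be the nonlocal operator $\mathcal{I}(u,x)=\inf_{i\in I}\sup_{j\in J}L_{K_{ij}}(u,x)$ with $K_{ij}\in\mathcal{K}_0$ for all $i\in I$, $j\in J$. Let $c,f\in L^\infty(\Omega)$ and let $g$ satisfy, for some constant $M_1$, $$|g(x,p)|\le M_1|p| \quad\text{for all } x\in\Omega,\ p\in\mathbb{R}^N .$$ Then for any $\tilde\Omega\subset\subset\Omega$ there exists a constant $C$, independent of $u$ and $f$, such that every viscosity solution $u\ge 0$ (in $\mathbb{R}^N$) of $$\mathcal{I}(u)+g(x,Du)+c(x)u=f(x)\quad\text{in }\Omega$$ satisfies $$\sup_{\tilde\Omega}u\le C\Big(\inf_{\tilde\Omega}u+\|f\|_\infty\Big).$$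
   Context: Fix constants $0<\gamma\le\Gamma<+\infty$ (the ellipticity constants). The class $\mathcal{K}_0$ consists of the kernels $K:\mathbb{R}^N\to\mathbb{R}$ with $K(y)=K(-y)$ for all $y$ and $\gamma|y|^{-(N+2s)}\le K(y)\le\Gamma|y|^{-(N+2s)}$. For $K\in\mathcal{K}_0$, $$L_K(u,x)=\mathrm{P.V.}\int_{\mathbb{R}^N}[u(y)-u(x)]K(x-y)\,dy,$$ and for measurable $A\subseteq\mathbb{R}^N$, $L_K[A](u,x)$ denotes the same integral taken over $A$. The index sets $I,J$ are compact metric spaces. Viscosity sense: an upper semicontinuous $u:\mathbb{R}^N\to\mathbb{R}$ is a viscosity subsolution of $\mathcal{I}(u)+g(x,Du)+c(x)u=f(x)$ at $x_0\in\Omega$ if for every $\rho>0$ with $B_\rho(x_0)\subset\Omega$ and each $\varphi\in C^2(B_\rho(x_0))\cap L^\infty(\mathbb{R}^N)$ such that $x_0$ is a maximum point of $u-\varphi$ in $B_\rho(x_0)$, $$\inf_{i\in I}\sup_{j\in J}\Big(L_{K_{ij}}[B_\rho(x_0)](\varphi,x_0)+L_{K_{ij}}[B_\rho(x_0)^c](u,x_0)\Big)+g(x_0,D\varphi(x_0))+c(x_0)u(x_0)\ge f(x_0).$$ Supersolutions are defined analogously (lower semicontinuous $u$, minimum points of $u-\varphi$, reversed inequality). A viscosity solution is both a sub- and a supersolution.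
   Formalization: Here c and f are measurable functions bounded at every point of Ω and ‖f‖_∞ is the supremum of |f| over Ω; with the essential supremum the claim fails, since viscosity inequalities may be tested only on a null set. *)

(* Defs.v *)
From HB Require Import structures.
From mathcomp Require Import all_boot all_order all_algebra.
From mathcomp Require Import all_classical all_reals all_analysis.

Set Implicit Arguments.
Unset Strict Implicit.
Unset Printing Implicit Defensive.

Import Order.TTheory GRing.Theory Num.Theory.
Import numFieldNormedType.Exports.

Local Open Scope classical_set_scope.
Local Open Scope ring_scope.

(* R^N is 'rV[R]_N.  The library norm on 'rV[R]_N is the sup norm: it induces
   the usual topology (and the usual bounded sets), but the kernels and the
   balls of this file are taken with respect to the Euclidean norm below. *)
Section Euclidean.
Context {R : realType} {N : nat}.
Implicit Types x y : 'rV[R]_N.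

Definition enorm x : R := Num.sqrt (\sum_i x ord0 i ^+ 2).

Definition eball x (r : R) : set 'rV[R]_N := [set y | enorm (y - x) < r].

End Euclidean.

(* Lebesgue measure on R^N: Caratheodory's construction from the outer measure
   given by countable coverings by boxes.  Thus "measurable" means Lebesgue
   measurable, and the measure is complete. *)
Section LebesgueOuterMeasure.
Context {R : realType} {N : nat}.
Implicit Types (ab : 'rV[R]_N * 'rV[R]_N) (A : set 'rV[R]_N).

Definition box ab : set 'rV[R]_N :=
  [set x | forall i, ab.1 ord0 i <= x ord0 i <= ab.2 ord0 i].

Definition box_vol ab : R :=
  \prod_i Num.max 0 (ab.2 ord0 i - ab.1 ord0 i).

Definition box_cover A (D : set ('rV[R]_N * 'rV[R]_N)) :=
  countable D /\ A `<=` \bigcup_(ab in D) box ab.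

Definition leb_outer A : \bar R :=
  ereal_inf [set (\esum_(ab in D) (box_vol ab)%:E)%E | D in box_cover A].

Local Open Scope ereal_scope.

Lemma box_vol_ge0 ab : 0 <= (box_vol ab)%:E.
Proof. by rewrite lee_fin; apply: prodr_ge0 => i _; rewrite le_max lexx. Qed.

Lemma leb_outer_ge0 A : 0 <= leb_outer A.
Proof.
apply: le_ereal_inf_tmp => _ [D _ <-].
by apply: esum_ge0 => ab _; exact: box_vol_ge0.
Qed.

Lemma leb_outer0 : leb_outer set0 = 0.
Proof.
apply/eqP; rewrite eq_le leb_outer_ge0 andbT.
apply: ereal_inf_lbound; exists set0; last exact: esum_set0.
by split; [exact: countable0 | exact: sub0set].
Qed.

Lemma le_leb_outer : {homo leb_outer : A B / A `<=` B >-> A <= B}.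
Proof.
move=> A B AB; apply: ereal_inf_le_tmp => _ [D [cD BD] <-].
by exists D => //; split=> //; exact: subset_trans AB BD.
Qed.

Lemma leb_outer_sigma_subadditive : sigma_subadditive leb_outer.
Proof.
move=> A; have [[i ioo]|] := pselect (exists i, leb_outer (A i) = +oo).
  rewrite (eseries_pinfty _ _ ioo) ?leey// => n _.
  by rewrite -ltNye (lt_le_trans _ (leb_outer_ge0 _)).
rewrite -forallNE => Aoo; apply/lee_addgt0Pr => e e0.
rewrite (le_trans _ (epsilon_trick _ _ (ltW e0)))//; last first.
  by move=> n; exact: leb_outer_ge0.
have [G PG] : {G : nat -> set ('rV[R]_N * 'rV[R]_N) & forall n,
    box_cover (A n) (G n) /\ \esum_(ab in G n) (box_vol ab)%:E
      <= leb_outer (A n) + (e / (2 ^ n.+1)%:R)%:E}.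
  apply: (@choice _ _ (fun n D => box_cover (A n) D /\
    \esum_(ab in D) (box_vol ab)%:E
      <= leb_outer (A n) + (e / (2 ^ n.+1)%:R)%:E)) => n.
  have en0 : (0 < e / (2 ^ n.+1)%:R)%R by rewrite divr_gt0// ltr0n expn_gt0.
  have fA : leb_outer (A n) \is a fin_num.
    by rewrite ge0_fin_numE ?leb_outer_ge0// ltey; apply/eqP; exact: Aoo.
  have [_ [D AD <-] /ltW lD] := lb_ereal_inf_adherent en0 fA.
  by exists D.
apply: (@le_trans _ _
    (\esum_(ab in \bigcup_n G n) (box_vol ab)%:E)).
  apply: ereal_inf_lbound; exists (\bigcup_n G n) => //; split.
    by apply: bigcup_countable => // n _; exact: (PG n).1.1.
  move=> x [n _ Anx]; have [ab Gab abx] := (PG n).1.2 _ Anx.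
  by exists ab => //; exists n.
rewrite seqDU_bigcup_eq nneseries_sum_bigcup; last 2 first.
- exact: trivIset_seqDU.
- exact: box_vol_ge0.
apply: lee_nneseries => [n _ _|n _].
  by apply: esum_ge0 => ab _; exact: box_vol_ge0.
apply: le_trans (PG n).2.
apply: le_ereal_sup => _ [F [fF FG] <-]; exists F => //; split=> //.
exact: subset_trans FG (@subset_seqDU _ _ _).
Qed.

HB.instance Definition _ := isOuterMeasure.Build R 'rV[R]_N leb_outer
  leb_outer0 leb_outer_ge0 le_leb_outer leb_outer_sigma_subadditive.

End LebesgueOuterMeasure.

Notation lebesgue_rV R N :=
  (caratheodory_type (@leb_outer R N : {outer_measure set _ -> \bar R})).

Definition leb {R : realType} {N : nat} : set (lebesgue_rV R N) -> \bar R :=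
  @leb_outer R N.

HB.instance Definition _ {R : realType} {N : nat} :=
  Measure.copy (@leb R N)
    ((@leb_outer R N : {outer_measure set _ -> \bar R})
       : set (lebesgue_rV R N) -> \bar R).

Section FunctionSpaces.
Context {R : realType} {N : nat}.
Implicit Types (D : set 'rV[R]_N) (h : 'rV[R]_N -> R).

Definition lebesgue_measurable_fun D h :=
  measurable_fun (D : set (lebesgue_rV R N)) (h : lebesgue_rV R N -> R).

(* The viscosity inequalities use the value of the coefficients at every single
   point of the domain, so that modifying a coefficient on a null set changes
   the equation.  Hence elements of L^oo are genuine bounded measurable
   functions, not a.e. classes, and the norm is the supremum. *)
Definition Linfty D h :=
  lebesgue_measurable_fun D h /\ exists M, forall x, D x -> `|h x| <= M.

Definition Linfty_norm D h : \bar R :=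
  ereal_sup [set (`|h x|)%:E | x in D].

Definition partial (i : 'I_N) h (x : 'rV[R]_N) : R :=
  'D_(delta_mx ord0 i) h x.

Definition grad h (x : 'rV[R]_N) : 'rV[R]_N := \row_i partial i h x.

Definition C1_on D h := forall x, D x -> forall i : 'I_N,
  derivable h x (delta_mx ord0 i) /\ {for x, continuous (partial i h)}.

Definition C2_on D h := C1_on D h /\ forall i : 'I_N, C1_on D (partial i h).

Definition lsc h := lower_semicontinuous (fun x => (h x)%:E).
Definition usc h := lower_semicontinuous (fun x => (- h x)%:E).

End FunctionSpaces.

Section NonlocalOperators.
Context {R : realType} {N : nat}.
Implicit Types (K u : 'rV[R]_N -> R) (A : set 'rV[R]_N) (x : 'rV[R]_N).

Definition kernel_class (gamma Gamma s : R) K :=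
  [/\ lebesgue_measurable_fun setT K,
      forall y, K y = K (- y) &
      forall y, y != 0 ->
        gamma * enorm y `^ (- (N%:R + 2 * s)) <= K y <=
        Gamma * enorm y `^ (- (N%:R + 2 * s))].

(* Principal value at x.  The integral is extended-real valued: for u >= 0 far
   from x it may be +oo. *)
Definition LK K A u x : \bar R :=
  lim ((fun e : R => \int[leb]_(y in A `\` eball x e)
          ((u y - u x) * K (x - y))%:E)%E @ 0^'+).

Definition infsup (I J : Type) (F : I -> J -> \bar R) : \bar R :=
  ereal_inf (range (fun i => ereal_sup (range (F i)))).

Section Viscosity.
Context {I J : Type}.
Variables (K : I -> J -> 'rV[R]_N -> R) (g : 'rV[R]_N -> 'rV[R]_N -> R).
Variables (c f : 'rV[R]_N -> R) (Omega : set 'rV[R]_N) (u : 'rV[R]_N -> R).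

Definition test_value (rho : R) (phi : 'rV[R]_N -> R) x0 : \bar R :=
  (infsup (fun i j => LK (K i j) (eball x0 rho) phi x0
                    + LK (K i j) (~` eball x0 rho) u x0)
   + (g x0 (grad phi x0) + c x0 * u x0)%:E)%E.

Definition test_function (rho : R) (phi : 'rV[R]_N -> R) x0 :=
  [/\ 0 < rho, eball x0 rho `<=` Omega, C2_on (eball x0 rho) phi &
      Linfty setT phi].

Definition viscosity_subsolution := usc u /\
  forall x0, Omega x0 -> forall rho phi, test_function rho phi x0 ->
    (forall y, eball x0 rho y -> u y - phi y <= u x0 - phi x0) ->
    ((f x0)%:E <= test_value rho phi x0)%E.

Definition viscosity_supersolution := lsc u /\
  forall x0, Omega x0 -> forall rho phi, test_function rho phi x0 ->
    (forall y, eball x0 rho y -> u x0 - phi x0 <= u y - phi y) ->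
    (test_value rho phi x0 <= (f x0)%:E)%E.

Definition viscosity_solution :=
  viscosity_subsolution /\ viscosity_supersolution.

End Viscosity.
End NonlocalOperators.

Section Domains.
Context {R : realType} {N : nat}.
Implicit Types D E : set 'rV[R]_N.

Definition bounded_domain D :=
  [/\ open D, connected D, D !=set0 & bounded_set D].

Definition compactly_contained E D :=
  compact (closure E) /\ closure E `<=` D.

End Domains.

(* Main.v *)
Require Import Defs.
From mathcomp Require Import all_boot all_order all_algebra.
From mathcomp Require Import all_classical all_reals all_analysis.
From mathcomp Require Import measurable_realfun ring lra.
Import Order.TTheory GRing.Theory Num.Theory.
Import numFieldNormedType.Exports.
Local Open Scope classical_set_scope.
Local Open Scope ring_scope.

(** The order [s] is fixed and the kernels are bounded below as well as above by
    multiples of the power [|y|^-(N + 2 s)], so each half of the inequality can be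
    read off from the equation at a single contact point with a paraboloid.  A
    solution is continuous, being upper and lower semicontinuous, so contact
    points exist by compactness.

    Tail estimate.  Let [u z <= M] and [|f| <= M].  A paraboloid of height
    comparable to [M] with vertex [z] touches [u] from below at some [x1],
    where [u x1 <= M].  The equation bounds the operator at [x1] from above by a
    multiple of [M].  The difference of [u] and the paraboloid is nonnegative
    near [x1], the paraboloid itself contributes a multiple of [M], and away
    from [x1] the kernel is bounded below; hence the integral of [u] against a
    weight decaying like the kernel is at most a multiple of [M]
    ([supersolution_tail]).  The tail charges every ball, so this single step
    relates any two points of the domain.

    Local boundedness.  Maximise [u y * (r - |y - z|) ^+ N] over the ball of
    radius [r].  Around the maximum point [xh], at distance [d] from the
    boundary, [u <= (1 + eta) * u xh] on a ball of radius comparable to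
    [eta * d], so a paraboloid of opening [eta * u xh / rho ^+ 2] touches [u]
    from above at a point [x0] with [rho] comparable to [eta * d].  At [x0] the
    far part of the operator contains a negative multiple of
    [u x0 * rho^-(2 s)], because subtracting [u x0] costs that much mass of the
    kernel outside the ball of radius [rho].  The paraboloid, the gradient term (here [2 s > 1] is used)
    and the zero order term contribute at most [C * eta] times the same
    quantity, so for small [eta] only the tail is left to balance it.  The
    tail is at most [C * M * rho^-(N + 2 s)], and the outcome
    [u xh * rho ^+ N <= C * M] is what the weight in the maximisation was chosen
    for ([subsolution_bound]).

    The principal value meets the test function only through the quadratic part
    of a paraboloid: the linear part is odd about the contact point and
    integrates to zero on annuli ([near_linear], [LK_paraboloid]).  This rests
    on the invariance of Lebesgue measure under point reflections, and the
    lower bound of the kernel mass rests on the fact that boxes do not have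
    less measure than their volume; both are derived below from the definition
    of the outer measure ([leb_outer_reflect], [leb_outer_cube_ge]). *)

(** * Measurability for Lebesgue measure on R^N *)

Section OuterMeasure.
Context {R : realType} {N : nat}.
Local Notation V := 'rV[R]_N.
Implicit Types (A X : set V).

Lemma esum_image_le (T : pointedType) (T' : choiceType) (D : set T) (f : T -> T')
    (v : T' -> \bar R) : (forall y, (0 <= v y)%E) ->
  (\esum_(y in f @` D) v y <= \esum_(x in D) v (f x))%E.
Proof.
move=> v0.
have [g gP] : {g : T' -> T & forall y, (f @` D) y -> D (g y) /\ f (g y) = y}.
  apply: (@choice _ _ (fun y x => (f @` D) y -> D x /\ f x = y)) => y.
  have [[x Dx <-]|nfy] := pselect ((f @` D) y); first by exists x.
  by exists point => /nfy.
have gi : set_inj (f @` D) g.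
  move=> y z; rewrite !inE => /gP[_ fy] /gP[_ fz] /(congr1 f).
  by rewrite fy fz.
have -> : (\esum_(y in f @` D) v y = \esum_(x in g @` (f @` D)) v (f x))%E.
  rewrite (esum_image (f @` D) g (fun x => v (f x)))//; apply: eq_esum => y fDy.
  by rewrite (gP _ fDy).2.
apply: ereal_sup_le => _ [F [fF FG] <-]; exists F => //; split=> //.
by apply: subset_trans FG _ => _ [y fDy <-]; exact: (gP _ fDy).1.
Qed.

(** Cutting or reflecting a covering moves its boxes by a map [h] that need not
    be injective; passing to the image only lowers the total volume. *)
Lemma leb_outer_boxes_le (D : set (V * V)) (h : V * V -> V * V) X :
  countable D -> X `<=` \bigcup_(ab in D) box (h ab) ->
  (leb_outer X <= \esum_(ab in D) (box_vol (h ab))%:E)%E.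
Proof.
move=> cD XD.
apply: (@le_trans _ _ (\esum_(ab in h @` D) (box_vol ab)%:E)%E).
  apply: ereal_inf_lbound; exists (h @` D) => //; split.
    exact: sub_countable (card_image_le _ _) cD.
  by move=> x /XD [ab Dab hx]; exists (h ab) => //; exists ab.
by apply: (@esum_image_le _ _ D h (fun ab => (box_vol ab)%:E)) => ab; exact: box_vol_ge0.
Qed.

Definition set_coord (i : 'I_N) (t : R) (a : V) : V :=
  \row_j (if j == i then t else a ord0 j).

Lemma box_vol_split (i : 'I_N) (t : R) (ab : V * V) :
  box_vol (ab.1, set_coord i (Num.min (ab.2 ord0 i) t) ab.2) +
  box_vol (set_coord i (Num.max (ab.1 ord0 i) t) ab.1, ab.2) = box_vol ab.
Proof.
rewrite /box_vol/= [X in X + _](bigD1 i)//= [X in _ + X](bigD1 i)//= [RHS](bigD1 i)//= !mxE !eqxx.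
have E1 : \prod_(j < N | j != i) Num.max 0 (set_coord i (Num.min (ab.2 ord0 i) t) ab.2 ord0 j - ab.1 ord0 j)
   = \prod_(j < N | j != i) Num.max 0 (ab.2 ord0 j - ab.1 ord0 j).
  by apply: eq_bigr => j /negbTE ji; rewrite !mxE ji.
have E2 : \prod_(j < N | j != i) Num.max 0 (ab.2 ord0 j - set_coord i (Num.max (ab.1 ord0 i) t) ab.1 ord0 j)
   = \prod_(j < N | j != i) Num.max 0 (ab.2 ord0 j - ab.1 ord0 j).
  by apply: eq_bigr => j /negbTE ji; rewrite !mxE ji.
rewrite E1 E2 -mulrDl; congr (_ * _).
rewrite /Num.max /Num.min; repeat case: ifPn => //; rewrite -?leNgt; lra.
Qed.

(** Cutting every box of a covering along a hyperplane leaves the total volume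
    unchanged ([box_vol_split]), which is Caratheodory's criterion. *)
Lemma halfspace_measurable (i : 'I_N) (t : R) :
  measurable ([set x | x ord0 i <= t] : set (lebesgue_rV R N)).
Proof.
apply: le_caratheodory_measurable => X.
apply: le_ereal_inf_tmp => _ [D [cD XD] <-].
apply: (@le_trans _ _ (\esum_(ab in D)
   ((box_vol (ab.1, set_coord i (Num.min (ab.2 ord0 i) t) ab.2))%:E +
  (box_vol (set_coord i (Num.max (ab.1 ord0 i) t) ab.1, ab.2))%:E))%E).
  rewrite esumD; try by move=> *; exact: box_vol_ge0.
  apply: leeD.
  - apply: (@leb_outer_boxes_le D
     (fun ab => (ab.1, set_coord i (Num.min (ab.2 ord0 i) t) ab.2))) => //.
    move=> x [/XD[ab Dab abx] xt]; exists ab => // j; rewrite /= mxE.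
    have := abx j; case: ifPn => // /eqP -> /andP[-> /= h].
    by rewrite le_min h.
  - apply: (@leb_outer_boxes_le D
     (fun ab => (set_coord i (Num.max (ab.1 ord0 i) t) ab.1, ab.2))) => //.
    move=> x [/XD[ab Dab abx] /negP]; rewrite -ltNge => xt.
    exists ab => // j; rewrite /= mxE.
    have := abx j; case: ifPn => // /eqP -> /andP[h -> /=].
    by rewrite andbT ge_max h ltW.
by apply: le_esum => ab _; rewrite -EFinD box_vol_split.
Qed.

Lemma box_measurable (ab : V * V) : measurable (box ab : set (lebesgue_rV R N)).
Proof.
have -> : box ab = \bigcap_(i in [set: 'I_N]) ([set x : V | x ord0 i <= ab.2 ord0 i] `&`
    \bigcap_(n in [set: nat]) ~` [set x : V | x ord0 i <= ab.1 ord0 i - n.+1%:R^-1]).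
  apply/seteqP; split => [x abx i _|x abx i].
    have /andP[h1 h2] := abx i; split => // n _ /=; apply/negP; rewrite -ltNge.
    by rewrite (lt_le_trans _ h1)// ltrBlDr ltrDl invr_gt0.
  have [/= h1 h2] := abx i I; rewrite h1 andbT leNgt; apply/negP => xa.
  have [n] := ltr_add_invr xa.
  rewrite addrC -ltrBrDl addrC => h3; apply: (h2 n I) => /=.
  by rewrite ltW// ltrBrDr addrC -ltrBrDl addrC.
apply: fin_bigcap_measurable => // i _; apply: measurableI.
  exact: halfspace_measurable.
by apply: bigcap_measurable => // n _; apply: measurableC; exact: halfspace_measurable.
Qed.

Lemma ball_rV_coord (x y : V) (e : R) : 0 < e ->
  (forall i, `|x ord0 i - y ord0 i| < e) -> ball x e y.
Proof. by move=> e0 h; split => // i j; rewrite ord1; exact: h. Qed.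

(** An open set is the union of the boxes with rational vertices inside it. *)
Lemma open_measurable_rV A : open A -> measurable (A : set (lebesgue_rV R N)).
Proof.
move=> oA.
pose rbox (p : 'rV[rat]_N * 'rV[rat]_N) : set V :=
  box (map_mx ratr p.1, map_mx ratr p.2).
have -> : A = \bigcup_p (if `[< rbox p `<=` A >] then rbox p else set0).
  apply/seteqP; split => [x Ax|x [p _]]; last by case: asboolP => // pA xp; exact: pA.
  have /nbhs_ballP[e /= e0 xeA] : nbhs x A by exact: open_nbhs_nbhs.
  have hl i : {q : rat | x ord0 i - e < ratr q < x ord0 i}.
    apply: cid; have : x ord0 i - e < x ord0 i by rewrite ltrBlDr ltrDl.
    by move=> /rat_in_itvoo[q]; rewrite in_itv/=; exists q.
  have hr i : {q : rat | x ord0 i < ratr q < x ord0 i + e}.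
    apply: cid; have : x ord0 i < x ord0 i + e by rewrite ltrDl.
    by move=> /rat_in_itvoo[q]; rewrite in_itv/=; exists q.
  exists (\row_i sval (hl i), \row_i sval (hr i)) => //.
  rewrite ifT.
    move=> i; rewrite !mxE; case: (hl i) => /= q /andP[_ /ltW->].
    by case: (hr i) => /= r /andP[/ltW-> _].
  apply/asboolP => y yb; apply: xeA; apply: ball_rV_coord => // i.
  have := yb i; rewrite !mxE; case: (hl i) => /= q /andP[q1 _].
  case: (hr i) => /= r /andP[_ r1] /andP[qy yr].
  by rewrite ltr_norml; apply/andP; split; lra.
apply: countable_bigcupT_measurable => // p; case: ifP => _ //.
exact: box_measurable.
Qed.

Lemma continuous_measurable_rV (u : V -> R) : continuous u ->
  measurable_fun setT (u : lebesgue_rV R N -> R).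
Proof.
move=> cu; apply: (measurability _ (RGenOInfty.measurableE R)) => //.
move=> _ [_ [t ->] <-]; rewrite setTI; apply: open_measurable_rV.
by apply: open_comp => // x _; exact: cu.
Qed.

End OuterMeasure.

(** * Volume of boxes *)

Section BoxVolume.
Context {R : realType}.

Lemma le_nneseries_term (f : nat -> \bar R) (k : nat) :
  (forall n, (0 <= f n)%E) -> (f k <= \sum_(n <oo) f n)%E.
Proof.
move=> f0; apply: (le_trans _ (@nneseries_lim_ge _ f xpredT 0%N k.+1 (fun n _ _ => f0 n))).
by rewrite big_nat_recr//= leeDr// sume_ge0.
Qed.

Definition itv_indic (a b t : R) : R := \1_(`[a, b]%classic) t.

Lemma itv_indic_ge0 a b t : 0 <= itv_indic a b t.
Proof. by rewrite /itv_indic indicE. Qed.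

(** Integrating the covering inequality one coordinate at a time, with one
    dimensional Lebesgue measure, replaces indicators by side lengths.  The
    weights [c] make the induction go through: on the slice where the last
    coordinate is fixed they absorb its indicator. *)
Lemma weighted_cover_volume (n : nat) (l : nat -> R) (r L : R)
    (c : nat -> R) (a b : nat -> nat -> R) :
  0 <= r -> 0 <= L -> (forall k, 0 <= c k) ->
  (forall x : nat -> R, (forall i, (i < n)%N -> l i <= x i <= l i + r) ->
     (L%:E <= \sum_(k <oo) (c k * \prod_(i < n) itv_indic (a k i) (b k i) (x i))%:E)%E) ->
  ((L * r ^+ n)%:E <= \sum_(k <oo) (c k * \prod_(i < n) Num.max 0%R (b k i - a k i))%:E)%E.
Proof.
move=> r0 L0; elim: n c => [|n IHn] c c0 Hc.
  rewrite expr0 mulr1; apply: (le_trans (Hc l _)) => //.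
  by apply: lee_nneseries => [k _ _|k _]; rewrite !big_ord0// mulr1 lee_fin.
pose D : set R := `[l n, l n + r]%classic.
pose w k := c k * \prod_(i < n) Num.max 0 (b k i - a k i).
have w0 k : 0 <= w k.
  by rewrite mulr_ge0// prodr_ge0// => i _; rewrite le_max lexx.
have slice t : D t -> ((L * r ^+ n)%:E <=
    \sum_(k <oo) ((w k)%:E * (itv_indic (a k n) (b k n) t)%:E))%E.
  rewrite /D /= in_itv/= => Dt.
  have := IHn (fun k => c k * itv_indic (a k n) (b k n) t).
  have E k : ((c k * itv_indic (a k n) (b k n) t) * \prod_(i < n) Num.max 0 (b k i - a k i))%:E
      = ((w k)%:E * (itv_indic (a k n) (b k n) t)%:E)%E.
    by rewrite -EFinM /w mulrAC.
  rewrite (eq_eseriesr (fun k _ => E k)).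
  apply => [k|x Hx]; first by rewrite mulr_ge0// itv_indic_ge0.
  have /Hc : forall i, (i < n.+1)%N -> l i <= (if i == n then t else x i) <= l i + r.
    move=> i; rewrite ltnS leq_eqVlt; case: eqP => [->//|_ /=]; exact: Hx.
  move=> /le_trans; apply; apply: lee_nneseries => [k _ _|k _].
    by rewrite lee_fin mulr_ge0// prodr_ge0// => i _; exact: itv_indic_ge0.
  rewrite lee_fin big_ord_recr/= eqxx -mulrA [X in c k * X]mulrC.
  rewrite (eq_bigr (fun i : 'I_n => itv_indic (a k i) (b k i) (x i)))// => i _.
  by rewrite ltn_eqF.
have mD : measurable D by exact: measurable_itv.
have mind k : measurable_fun D (fun t => (itv_indic (a k n) (b k n) t)%:E).
  apply/measurable_EFinP; apply: measurable_indic; exact: measurable_itv.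
have intL : (\int[lebesgue_measure]_(t in D) (L * r ^+ n)%:E = (L * r ^+ n.+1)%:E)%E.
  rewrite integral_cst//= /D lebesgue_measure_itv/= lte_fin ltrDl.
  case: ltP => [_|r0']; first by rewrite -EFinB addrAC subrr add0r -EFinM -mulrA exprSr.
  have -> : r = 0 by apply/eqP; rewrite eq_le r0 r0'.
  by rewrite exprS mul0r mulr0 mule0.
rewrite -intL.
apply: (@le_trans _ _ (\int[lebesgue_measure]_(t in D)
   (\sum_(k <oo) ((w k)%:E * (itv_indic (a k n) (b k n) t)%:E)))%E).
  apply: ge0_le_integral => //.
  - by move=> t _; rewrite lee_fin mulr_ge0// exprn_ge0.
  - apply: (@ge0_emeasurable_sum _ _ _ D
      (fun k t => ((w k)%:E * (itv_indic (a k n) (b k n) t)%:E)%E) xpredT).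
      by move=> k t _ _; rewrite mule_ge0 ?lee_fin ?itv_indic_ge0.
    move=> k _; apply: measurable_funeM. exact: mind.
rewrite integral_nneseries//; last 2 first.
- move=> k; have := mind k; exact: measurable_funeM.
- by move=> k t _; rewrite mule_ge0 ?lee_fin ?itv_indic_ge0.
apply: lee_nneseries => [k _ _|k _].
  by apply: integral_ge0 => t _; rewrite mule_ge0 ?lee_fin ?itv_indic_ge0.
have ind0 t : D t -> (0 <= (itv_indic (a k n) (b k n) t)%:E)%E.
  by move=> _; rewrite lee_fin itv_indic_ge0.
apply: (@le_trans _ _ ((w k)%:E *
    \int[lebesgue_measure]_(t in D) (itv_indic (a k n) (b k n) t)%:E)%E).
  rewrite le_eqVlt; apply/orP; left; apply/eqP.
  exact: (ge0_integralZl_EFin lebesgue_measure mD ind0 (mind k) (w0 k)).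
have mab : measurable (`[a k n, b k n]%classic : set R) by exact: measurable_itv.
have -> : (\int[lebesgue_measure]_(t in D) (itv_indic (a k n) (b k n) t)%:E =
    lebesgue_measure (`[a k n, b k n]%classic `&` D))%E.
  exact: integral_indic.
rewrite big_ord_recr/= mulrA [X in (_ <= X)%E]EFinM -/(w k); apply: lee_wpmul2l; first by rewrite lee_fin.
apply: (@le_trans _ _ (lebesgue_measure (`[a k n, b k n]%classic : set R))).
  by apply: le_measure; rewrite ?inE; [exact: measurableI|exact: mab|exact: subIsetl].
rewrite lebesgue_measure_itv/= lte_fin; case: ltP => h.
  by rewrite -EFinB lee_fin le_max lexx orbT.
by rewrite lee_fin le_max lexx.
Qed.
End BoxVolume.

Section BoxBound.
Context {R : realType} {N : nat}.
Local Notation V := 'rV[R]_N.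

(** A covering is a family of boxes whose indicators add up to at least one on
    the cube, so [weighted_cover_volume] applies with weights one on the indices
    of an injective enumeration of the covering, and zero elsewhere. *)
Lemma leb_outer_cube_ge (x : V) (r : R) : 0 <= r ->
  ((r ^+ N)%:E <= leb_outer (box (x, (\row_i (x ord0 i + r))%R)))%E.
Proof.
move=> r0; apply: le_ereal_inf_tmp => _ [D [cD QD] <-].
have [f fi] := countable_injP _ cD.
have [h hP] : {h : nat -> V * V & forall n ab, D ab -> f ab = n -> h n = ab}.
  apply: (@choice _ _ (fun n p => forall ab, D ab -> f ab = n -> p = ab)) => n.
  have [[ab [Dab fab]]|nex] := pselect (exists ab, D ab /\ f ab = n).
    by exists ab => ab' Dab' fab'; apply: fi; rewrite ?inE ?fab ?fab'.
  by exists point => ab Dab fab; exfalso; apply: nex; exists ab.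
pose P : pred nat := fun n => n \in f @` D.
have -> : (\esum_(ab in D) (box_vol ab)%:E =
           \sum_(n <oo | P n) (box_vol (h n))%:E)%E.
  rewrite nneseries_esum; last by move=> n _; exact: box_vol_ge0.
  have -> : [set n | P n] = f @` D by apply/seteqP; split => n; rewrite /P /= inE.
  rewrite (esum_image D f (fun n => (box_vol (h n))%:E))//.
  by apply: eq_esum => ab Dab; rewrite (hP _ ab).
pose ext (v : V) (i : nat) : R := if insub i is Some j then v ord0 j else 0.
have extE v (i : 'I_N) : ext v i = v ord0 i by rewrite /ext valK.
pose c n : R := (P n)%:R.
have := @weighted_cover_volume R N (ext x) r 1 c (fun n => ext (h n).1)
  (fun n => ext (h n).2) r0 ler01.
rewrite mul1r => H.
have -> : (\sum_(n <oo | P n) (box_vol (h n))%:E = \sum_(n <oo)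
   (c n * \prod_(i < N) Num.max 0%R (ext (h n).2 i - ext (h n).1 i)%R)%:E)%E.
  rewrite eseries_mkcond; apply: eq_eseriesr => n _; rewrite /c.
  case: (P n); last by rewrite mul0r.
  rewrite mul1r /box_vol; congr _%:E; apply: eq_bigr => i _.
  by rewrite !extE.
apply: H => [n|y Hy]; first by [].
have : box (x, \row_i (x ord0 i + r)) (\row_i y i).
  by move=> i /=; rewrite !mxE; have := Hy i (ltn_ord i); rewrite extE.
move=> /QD [ab Dab yab].
apply: le_trans; last first.
  apply: (@le_nneseries_term _ (fun n =>
    (c n * \prod_(i < N) itv_indic (ext (h n).1 i) (ext (h n).2 i) (y i))%:E) (f ab)) => n.
  by rewrite lee_fin mulr_ge0// prodr_ge0// => i _; exact: itv_indic_ge0.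
rewrite lee_fin (hP _ ab)// /c /P mem_set; last by exists ab.
rewrite mul1r big1// => i _; rewrite !extE /itv_indic indicE mem_set//=.
by rewrite in_itv/=; have := yab i; rewrite mxE.
Qed.

End BoxBound.

Section Reflection.
Context {R : realType} {N : nat}.
Local Notation V := 'rV[R]_N.
Local Notation W := (lebesgue_rV R N).

Definition reflect_at (a : V) (y : V) : V := a - y.

Lemma reflect_atK a : involutive (reflect_at a).
Proof. by move=> y; rewrite /reflect_at opprB addrC subrK. Qed.

Lemma reflect_at_preimageK a (A : set V) :
  reflect_at a @^-1` (reflect_at a @^-1` A) = A.
Proof. by apply/seteqP; split => y /=; rewrite reflect_atK. Qed.

Lemma leb_outer_reflect a (A : set V) :
  leb_outer (reflect_at a @^-1` A) = leb_outer A.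
Proof.
suff H (B : set V) : (leb_outer (reflect_at a @^-1` B) <= leb_outer B)%E.
  apply/eqP; rewrite eq_le H/=.
  by have := H (reflect_at a @^-1` A); rewrite reflect_at_preimageK.
apply: le_ereal_inf_tmp => _ [D [cD BD] <-].
pose h (ab : V * V) := (a - ab.2, a - ab.1).
have E ab : box_vol (h ab) = box_vol ab.
  rewrite /box_vol; apply: eq_bigr => i _; congr Num.max.
  by rewrite /h /= !mxE; ring.
under [leRHS]eq_esum => ab _ do rewrite -E.
apply: leb_outer_boxes_le => // y /BD[ab Dab yab]; exists ab => // i.
have := yab i; rewrite /h /reflect_at /= !mxE => /andP[h1 h2].
by apply/andP; split; lra.
Qed.

Lemma measurable_reflect_at a : measurable_fun setT (reflect_at a : W -> W).
Proof.
move=> _ A mA; rewrite setTI.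
suff : (@leb_outer R N).-caratheodory%classic (reflect_at a @^-1` A) by [].
move=> X; have := (mA : (@leb_outer R N).-caratheodory%classic A) (reflect_at a @^-1` X).
rewrite leb_outer_reflect -(leb_outer_reflect a (reflect_at a @^-1` X `&` A)).
rewrite -(leb_outer_reflect a (reflect_at a @^-1` X `&` ~` A)).
by rewrite !preimage_setI reflect_at_preimageK preimage_setC.
Qed.

(** The change of variables [y |-> a - y] turns the integral into its
    opposite. *)
Lemma integral_odd_reflect (a : V) (D : set W) (f : W -> R) :
  measurable D -> (forall y, D y -> D (reflect_at a y)) ->
  (forall y, f (reflect_at a y) = - f y) ->
  measurable_fun setT f ->
  leb.-integrable D (EFin \o f) ->
  (\int[leb]_(y in D) (f y)%:E = 0)%E.
Proof.
move=> mD Dr fr mf fi.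
have Dpre : reflect_at a @^-1` D = D.
  by apply/seteqP; split => y /= /Dr; rewrite ?reflect_atK.
have mEf : measurable_fun setT (EFin \o f) by exact/measurable_EFinP.
have mr := measurable_reflect_at a.
have frE : (EFin \o f) \o reflect_at a = (fun y => (- (f y))%:E).
  by apply/funext => y /=; rewrite fr.
have H : (\int[leb]_(y in D) (f y)%:E = \int[leb]_(y in D) (- f y)%:E)%E.
  have -> : (\int[leb]_(y in D) (f y)%:E =
      \int[pushforward leb (reflect_at a : W -> W)]_(y in D) (f y)%:E)%E.
    apply: eq_measure_integral => A mA AD.
    by rewrite /pushforward; exact/esym/leb_outer_reflect.
  rewrite (@integral_pushforward _ _ _ _ _ _ mr leb D (EFin \o f))//.
    by rewrite Dpre frE.
  rewrite Dpre frE.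
  rewrite (_ : (fun y => (- f y)%:E) = (fun y => - (EFin \o f) y)%E)//.
  exact: integrableN.
have fin : (\int[leb]_(y in D) (f y)%:E \is a fin_num)%E by exact: integrable_fin_num.
move: H; rewrite (_ : (fun y => (- f y)%:E) = (fun y => - (EFin \o f) y)%E)//.
rewrite integralN/=; last exact: integrable_add_def.
rewrite -(fineK fin) -EFinN => -[H]; congr _%:E; lra.
Qed.

End Reflection.

(** * The Euclidean norm *)

Section EuclideanNorm.
Context {R : realType} {N : nat}.
Local Notation V := 'rV[R]_N.
Implicit Types x y z : V.

Definition dot x y : R := \sum_i x ord0 i * y ord0 i.

Lemma enorm_ge0 x : 0 <= enorm x.
Proof. exact: sqrtr_ge0. Qed.

Lemma enorm_sqr x : enorm x ^+ 2 = \sum_i x ord0 i ^+ 2.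
Proof. by rewrite sqr_sqrtr// sumr_ge0// => i _; exact: sqr_ge0. Qed.

Lemma enorm0 : enorm (0 : V) = 0.
Proof.
by apply/eqP; rewrite -sqrf_eq0 enorm_sqr big1// => i _; rewrite mxE expr0n.
Qed.

Lemma enormN x : enorm (- x) = enorm x.
Proof. by rewrite /enorm; congr Num.sqrt; apply: eq_bigr => i _; rewrite mxE sqrrN. Qed.

Lemma enorm_distC x y : enorm (x - y) = enorm (y - x).
Proof. by rewrite -enormN opprB. Qed.

Lemma enormD_sqr x y :
  enorm (x + y) ^+ 2 = enorm x ^+ 2 + 2 * dot x y + enorm y ^+ 2.
Proof.
rewrite !enorm_sqr /dot mulr_sumr -!big_split/=.
by apply: eq_bigr => i _; rewrite !mxE; ring.
Qed.

(** Lagrange's identity: the defect in the Cauchy-Schwarz inequality is a sum of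
    squares. *)
Lemma dot_sqr_le x y : dot x y ^+ 2 <= enorm x ^+ 2 * enorm y ^+ 2.
Proof.
have : 0 <= \sum_i \sum_j (x ord0 i * y ord0 j - x ord0 j * y ord0 i) ^+ 2.
  by rewrite sumr_ge0// => i _; rewrite sumr_ge0// => j _; exact: sqr_ge0.
have -> : \sum_i \sum_j (x ord0 i * y ord0 j - x ord0 j * y ord0 i) ^+ 2 =
    2 * (enorm x ^+ 2 * enorm y ^+ 2 - dot x y ^+ 2).
  have E1 : enorm x ^+ 2 * enorm y ^+ 2 = \sum_i \sum_j x ord0 i ^+ 2 * y ord0 j ^+ 2.
    by rewrite !enorm_sqr mulr_suml; apply: eq_bigr => i _; rewrite mulr_sumr.
  have E2 : enorm x ^+ 2 * enorm y ^+ 2 = \sum_i \sum_j x ord0 j ^+ 2 * y ord0 i ^+ 2.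
    by rewrite E1 exchange_big.
  have E3 : dot x y ^+ 2 = \sum_i \sum_j (x ord0 i * y ord0 i) * (x ord0 j * y ord0 j).
    by rewrite expr2 mulr_suml; apply: eq_bigr => i _; rewrite mulr_sumr.
  have -> : forall a b : R, 2 * (a - b) = a + a - 2 * b by move=> a b; ring.
  rewrite {1}E1 E2 E3 mulr_sumr -sumrN -!big_split/=; apply: eq_bigr => i _.
  rewrite mulr_sumr -sumrN -!big_split/=; apply: eq_bigr => j _; ring.
by rewrite pmulr_rge0// subr_ge0.
Qed.

Lemma enormD x y : enorm (x + y) <= enorm x + enorm y.
Proof.
rewrite -(@ler_pXn2r _ 2)// ?nnegrE ?addr_ge0 ?enorm_ge0//.
rewrite enormD_sqr sqrrD lerD2r lerD2l -[X in _ <= X]mulr_natl ler_pM2l//.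
rewrite (le_trans (ler_norm _))// -(@ler_pXn2r _ 2)// ?nnegrE ?mulr_ge0 ?enorm_ge0//.
by rewrite real_normK ?num_real// exprMn dot_sqr_le.
Qed.

Lemma enorm_triangle y x z : enorm (x - z) <= enorm (x - y) + enorm (y - z).
Proof. by rewrite -(subrKA y) enormD. Qed.

Lemma coord_le_enorm x i : `|x ord0 i| <= enorm x.
Proof.
rewrite -(@ler_pXn2r _ 2)// ?nnegrE ?enorm_ge0// real_normK ?num_real//.
rewrite enorm_sqr (bigD1 i)//= lerDl sumr_ge0// => j _; exact: sqr_ge0.
Qed.

Lemma enorm_le_coord x (M : R) : 0 <= M -> (forall i, `|x ord0 i| <= M) ->
  enorm x <= N%:R * M.
Proof.
move=> M0 xM; have N0 : 0 <= N%:R * M by rewrite mulr_ge0.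
rewrite -(@ler_pXn2r _ 2)// ?nnegrE ?enorm_ge0// enorm_sqr.
apply: (@le_trans _ _ (\sum_(i < N) M ^+ 2)).
  apply: ler_sum => i _; rewrite -[_ ^+ 2]real_normK ?num_real//.
  by rewrite ler_pXn2r ?nnegrE.
rewrite sumr_const card_ord -[X in X <= _]mulr_natl exprMn ler_wpM2r ?sqr_ge0//.
rewrite -natrX ler_nat; case: (N) => // n; rewrite expnS expn1 leq_pmulr//.
Qed.

Lemma continuous_enorm_sqr z : continuous (fun y : V => enorm (y - z) ^+ 2).
Proof.
under eq_fun do rewrite enorm_sqr.
have addc : continuous (fun x : R * R => x.1 + x.2) by exact: add_continuous.
apply: (continuous_big addc (F := fun i (y : V) => (y - z) ord0 i ^+ 2)) => i _ y.
apply: (@continuous_comp _ _ _ (fun y : V => (y - z) ord0 i) (@GRing.exp R ^~ 2%N)).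
  apply: (@continuous_comp _ _ _ (fun y : V => y - z) (fun M : V => M ord0 i)).
    by apply: (@continuousB _ _ _ id (cst z)); [exact: cvg_id|exact: cst_continuous].
  exact: (@coord_continuous R 1 N ord0 i).
exact: exprn_continuous.
Qed.

Lemma enorm_sqrt_sqr (x : V) : enorm x = Num.sqrt (enorm x ^+ 2).
Proof. by rewrite sqrtr_sqr ger0_norm// enorm_ge0. Qed.

Lemma continuous_enorm z : continuous (fun y : V => enorm (y - z)).
Proof.
under eq_fun do rewrite enorm_sqrt_sqr.
move=> y; apply: (@continuous_comp _ _ _ (fun y : V => enorm (y - z) ^+ 2) Num.sqrt).
  exact: continuous_enorm_sqr.
exact: sqrt_continuous.
Qed.

Lemma eballE z r : eball z r = [set y : V | enorm (y - z) < r].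
Proof. by []. Qed.

Lemma open_eball z r : open (eball z r : set V).
Proof.
rewrite eballE (_ : [set y | _] = (fun y => enorm (y - z)) @^-1` [set t | t < r])//.
by apply: open_comp; [move=> y _; exact: continuous_enorm|exact: open_lt].
Qed.

Lemma nbhs_eball z x r : eball z r x -> nbhs x (eball z r).
Proof. by move=> zx; apply: open_nbhs_nbhs; split => //; exact: open_eball. Qed.

Lemma measurable_eball z r : measurable (eball z r : set (lebesgue_rV R N)).
Proof. exact/open_measurable_rV/open_eball. Qed.

Lemma measurable_enorm z :
  measurable_fun setT ((fun y => enorm (y - z)) : lebesgue_rV R N -> R).
Proof. exact/continuous_measurable_rV/continuous_enorm. Qed.

Lemma eball_sub z z' r r' : enorm (z' - z) + r' <= r -> eball z' r' `<=` (eball z r : set V).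
Proof.
move=> h y; rewrite /eball /= => yz; apply: le_lt_trans (enorm_triangle z' _ _) _.
by rewrite addrC (lt_le_trans _ h)// ltrD2l.
Qed.

Definition cball z r : set V := [set y | enorm (y - z) <= r].

Lemma compact_cball z r : compact (cball z r).
Proof.
apply: bounded_closed_compact.
  exists (`|z| + r); split => [|M MB y yz]; first exact: num_real.
  apply: (@le_trans _ _ (`|y - z| + `|z|)).
    by have := ler_normD (y - z) z; rewrite subrK.
  rewrite addrC; apply: le_trans (ltW MB); rewrite lerD2l; apply: le_trans yz.
  rewrite [leLHS]mx_normrE; apply: bigmax_le => [|[i j] _ /=]; first exact: enorm_ge0.
  by rewrite ord1; exact: coord_le_enorm.
rewrite (_ : cball z r = (fun y => enorm (y - z)) @^-1` [set t | t <= r])//.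
by apply: preimage_closed; [move=> y _; exact: continuous_enorm|exact: closed_le].
Qed.

End EuclideanNorm.

(** * Paraboloids as test functions *)

Section Paraboloids.
Context {R : realType} {N : nat}.
Local Notation V := 'rV[R]_N.
Implicit Types x y z : V.

(** The difference quotients of a quadratic function are affine in the step, so
    their limit is read off. *)
Lemma is_derive_affine_quotient (f : V -> R) (x v : V) (l c : R) :
  (forall h : R, f (h *: v + x) - f x = h * l + h ^+ 2 * c) ->
  is_derive x v f l.
Proof.
move=> fh.
have cv : (fun h : R => h^-1 *: ((f \o shift x) (h *: v) - f x)) @ 0^' --> l.
  have lin : (fun h : R => l + h * c) @ 0^' --> l.
    rewrite -[X in _ --> X]addr0 -[X in _ --> _ + X](mul0r c).
    apply: cvgD; first exact: cvg_cst.
    apply: cvgM; last exact: cvg_cst.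
    exact: nbhs_dnbhs.
  apply: cvg_trans lin; apply: near_eq_cvg; near=> h.
  have h0 : h != 0 by near: h; exact: nbhs_dnbhs_neq.
  rewrite /= /shift/= fh -[RHS]/(h^-1 * _).
  by field.
by split; [apply/cvg_ex; exists l|exact/cvg_lim].
Unshelve. all: by end_near. Qed.

Lemma dot_delta x (h : R) (i : 'I_N) : dot x (h *: delta_mx ord0 i) = h * x ord0 i.
Proof.
rewrite /dot (bigD1 i)//= !mxE !eqxx mulr1 mulrC big1 ?addr0// => j ji.
by rewrite !mxE eqxx/= (negbTE ji) !mulr0.
Qed.

Lemma enorm_delta_sqr (h : R) (i : 'I_N) : enorm (h *: delta_mx ord0 i : V) ^+ 2 = h ^+ 2.
Proof.
rewrite enorm_sqr (bigD1 i)//= !mxE !eqxx mulr1 big1 ?addr0// => j ji.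
by rewrite !mxE eqxx/= (negbTE ji) mulr0 expr0n.
Qed.

Lemma is_derive_enorm_sqr z x (i : 'I_N) (b : R) :
  is_derive x (delta_mx ord0 i) (fun y : V => b * enorm (y - z) ^+ 2)
    (2 * b * (x - z) ord0 i).
Proof.
apply: (@is_derive_affine_quotient _ _ _ _ b) => h.
have -> : h *: delta_mx ord0 i + x - z = (x - z) + h *: delta_mx ord0 i.
  by rewrite -addrA addrC.
rewrite enormD_sqr dot_delta enorm_delta_sqr.
ring.
Qed.

Lemma is_derive_coord z x (i j : 'I_N) (b : R) :
  is_derive x (delta_mx ord0 j : V) (fun y : V => b * (y - z) ord0 i)
    (b * (i == j)%:R).
Proof.
apply: (@is_derive_affine_quotient _ _ _ _ 0) => h.
rewrite !mxE eqxx/=; ring.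
Qed.

(** Cut off outside the ball where it is used as a test function, because test
    functions are bounded on the whole space. *)
Definition paraboloid (b : R) z x0 (rho : R) (y : V) : R :=
  if enorm (y - x0) < rho then b * enorm (y - z) ^+ 2 else 0.

Variables (b : R) (z x0 : V) (rho : R).
Local Notation phi := (paraboloid b z x0 rho).

Lemma paraboloid_near x : eball x0 rho x ->
  \forall y \near x, b * enorm (y - z) ^+ 2 = phi y.
Proof.
move=> bx; have /nbhs_eball := bx; apply: filterS => y.
by rewrite /eball/= /paraboloid => ->.
Qed.

Lemma is_derive_paraboloid x (i : 'I_N) : eball x0 rho x ->
  is_derive x (delta_mx ord0 i) phi (2 * b * (x - z) ord0 i).
Proof.
by move=> bx; exact: (near_eq_is_derive (paraboloid_near x bx) (is_derive_enorm_sqr z x i b)).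
Qed.

Lemma partial_paraboloid x (i : 'I_N) : eball x0 rho x ->
  partial i phi x = 2 * b * (x - z) ord0 i.
Proof. by move=> bx; rewrite /partial; have [_ ->] := is_derive_paraboloid x i bx. Qed.

Lemma partial_paraboloid_near x (i : 'I_N) : eball x0 rho x ->
  \forall y \near x, 2 * b * (y - z) ord0 i = partial i phi y.
Proof.
move=> bx; have /nbhs_eball := bx; apply: filterS => y yb.
by rewrite partial_paraboloid.
Qed.

Lemma is_derive_partial_paraboloid x (i j : 'I_N) : eball x0 rho x ->
  is_derive x (delta_mx ord0 j) (partial i phi) (2 * b * (i == j)%:R).
Proof.
move=> bx.
exact: (near_eq_is_derive (partial_paraboloid_near x i bx) (is_derive_coord z x i j (2 * b))).
Qed.

Lemma continuous_coordB (i : 'I_N) : continuous (fun y : V => (y - z) ord0 i).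
Proof.
move=> y; apply: (@continuous_comp _ _ _ (fun y : V => y - z) (fun M : V => M ord0 i)).
  by apply: (@continuousB _ _ _ id (cst z)); [exact: cvg_id|exact: cst_continuous].
exact: (@coord_continuous R 1 N ord0 i).
Qed.

Lemma near_eq_continuous (f g : V -> R) x :
  (\forall y \near x, f y = g y) -> {for x, continuous f} -> {for x, continuous g}.
Proof.
move=> fg cf; suff : g @ x --> g x by [].
have /= <- := nbhs_singleton fg.
exact: cvg_trans (near_eq_cvg fg) cf.
Qed.

Lemma C2_paraboloid : C2_on (eball x0 rho) phi.
Proof.
split=> [x bx i|i x bx j]; split.
- by have [] := is_derive_paraboloid x i bx.
- apply: (near_eq_continuous _ _ _ (partial_paraboloid_near x i bx)).
  by apply: continuousM; [exact: cst_continuous|exact: continuous_coordB].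
- by have [] := is_derive_partial_paraboloid _ i j bx.
- apply: (@near_eq_continuous (cst (2 * b * (i == j)%:R))); last exact: cst_continuous.
  have /nbhs_eball := bx; apply: filterS => y yb.
  by rewrite /partial/=; have [_ ->] := is_derive_partial_paraboloid _ i j yb.
Qed.

Lemma measurable_paraboloid : measurable_fun setT (phi : lebesgue_rV R N -> R).
Proof.
apply: measurable_fun_ifT.
- by apply: measurable_fun_ltr; [exact: measurable_enorm|exact: measurable_cst].
- apply: measurable_funM; first exact: measurable_cst.
  by apply: continuous_measurable_rV; exact: continuous_enorm_sqr.
- exact: measurable_cst.
Qed.

Lemma Linfty_paraboloid : 0 <= rho -> Linfty setT phi.
Proof.
move=> rho0; split; first exact: measurable_paraboloid.
exists (`|b| * (rho + enorm (x0 - z)) ^+ 2) => y _; rewrite /paraboloid.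
case: ifPn => yb; last by rewrite normr0 mulr_ge0 ?sqr_ge0.
rewrite normrM ler_wpM2l// ger0_norm ?sqr_ge0// ler_pXn2r ?nnegrE ?addr_ge0 ?enorm_ge0//.
by apply: le_trans (enorm_triangle x0 _ _) _; rewrite lerD2r ltW.
Qed.

Lemma grad_paraboloid x : eball x0 rho x ->
  enorm (grad phi x) = 2 * `|b| * enorm (x - z).
Proof.
move=> bx; have N0 : 0 <= 2 * `|b| * enorm (x - z).
  by rewrite mulr_ge0 ?mulr_ge0 ?enorm_ge0.
apply/eqP; rewrite -(@eqrXn2 _ 2)// ?enorm_ge0// exprMn !enorm_sqr mulr_sumr.
apply/eqP; apply: eq_bigr => i _; rewrite mxE partial_paraboloid//.
by rewrite !exprMn real_normK ?num_real.
Qed.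

Lemma paraboloidE y : eball x0 rho y -> phi y = b * enorm (y - z) ^+ 2.
Proof. by rewrite /eball/= /paraboloid => ->. Qed.

Lemma eball_center : 0 < rho -> eball x0 rho x0.
Proof. by rewrite /eball/= subrr enorm0. Qed.

(** The form in which the principal value sees a paraboloid: a part that is odd
    about the contact point [x0], and an even one independent of the vertex. *)
Lemma paraboloid_expand y : 0 < rho -> eball x0 rho y ->
  phi y - phi x0 = 2 * b * dot (x0 - z) (y - x0) + b * enorm (y - x0) ^+ 2.
Proof.
move=> rho0 yb; rewrite !paraboloidE//; last exact: eball_center.
have -> : y - z = (x0 - z) + (y - x0) by rewrite [RHS]addrC subrKA.
by rewrite enormD_sqr; ring.
Qed.

End Paraboloids.

(** * Integrals of powers of the distance *)

Section PowerIntegrals.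
Context {R : realType} {N : nat}.
Local Notation V := 'rV[R]_N.
Local Notation W := (lebesgue_rV R N).

Lemma leb_eball_le (x : V) (r : R) : 0 <= r ->
  (leb (eball x r : set W) <= ((2 * r) ^+ N)%:E)%E.
Proof.
move=> r0; apply: ereal_inf_lbound.
exists [set (\row_i (x ord0 i - r), \row_i (x ord0 i + r))].
  split; first exact: countable1.
  move=> y yx; exists (\row_i (x ord0 i - r), \row_i (x ord0 i + r)) => // i /=.
  rewrite !mxE -ler_distl.
  by have := coord_le_enorm (y - x) i; rewrite !mxE => /le_trans; apply; exact: ltW.
rewrite esum_set1; last exact: box_vol_ge0.
congr _%:E; rewrite /box_vol (eq_bigr (fun=> 2 * r)); first by rewrite prodr_const card_ord.
move=> i _ /=; rewrite !mxE (_ : _ - _ = 2 * r); last by ring.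
by apply/max_idPr; rewrite mulr_ge0.
Qed.

Lemma geometric_series_le (M lam : R) : 0 <= M -> 0 <= lam < 1 ->
  (\sum_(k <oo) (M * lam ^+ k)%:E <= (M / (1 - lam))%:E)%E.
Proof.
move=> M0 /andP[l0 l1].
apply: lime_le.
  by apply: is_cvg_nneseries => k _ _; rewrite lee_fin mulr_ge0 ?exprn_ge0.
apply: nearW => n; rewrite sumEFin lee_fin.
have d0 : 0 < 1 - lam by rewrite subr_gt0.
rewrite ler_pdivlMr// -mulr_sumr -mulrA ler_piMr// big_mkord.
rewrite (_ : _ * _ = 1 - lam ^+ n); first by rewrite lerBlDr lerDl exprn_ge0.
by rewrite mulrC -[RHS]opprB subrX1 -mulNr opprB.
Qed.

(** A substitute for polar coordinates: on a nested family of balls with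
    geometrically decreasing masses, [h] lies below the sum of the functions
    [a k] times the indicator of the ball of radius [r k]. *)
Lemma ge0_integral_le_balls (D : set W) (h : W -> R) (x : V) (a r : nat -> R) (M lam : R) :
  measurable D -> measurable_fun D h -> (forall y, D y -> 0 <= h y) ->
  (forall k, 0 <= a k) -> (forall k, 0 <= r k) -> 0 <= M -> 0 <= lam < 1 ->
  (forall y, D y -> exists k, eball x (r k) y /\ h y <= a k) ->
  (forall k, a k * (2 * r k) ^+ N <= M * lam ^+ k) ->
  (\int[leb]_(y in D) (h y)%:E <= (M / (1 - lam))%:E)%E.
Proof.
move=> mD mh h0 a0 r0 M0 lam01 cov mass.
pose F k (y : W) : \bar R := ((a k)%:E * (\1_(eball x (r k) : set W) y : R)%:E)%E.
have F0 k y : D y -> (0 <= F k y)%E.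
  by move=> _; rewrite mule_ge0 ?lee_fin ?a0.
have mI k : measurable_fun D (fun y : W => (\1_(eball x (r k) : set W) y : R)%:E).
  by apply/measurable_EFinP; apply: measurable_indic; exact: measurable_eball.
have mF k : measurable_fun D (F k).
  by apply: measurable_funeM; exact: mI.
apply: (@le_trans _ _ (\int[leb]_(y in D) \sum_(k <oo) F k y)%E).
  apply: ge0_le_integral; first exact: mD.
  - by move=> y Dy; rewrite lee_fin h0.
  - by apply/measurable_EFinP.
  - apply: (@ge0_emeasurable_sum _ _ _ D F xpredT) => k; first by move=> y Dy _; exact: F0.
    by move=> _; exact: mF.
  - move=> y Dy; have [k [yk hk]] := cov y Dy.
    apply: le_trans (le_nneseries_term _ k (fun n => F0 n y Dy)).
    by rewrite /F indicE mem_set//= mule1 lee_fin.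
rewrite (integral_nneseries leb mD mF (fun k y Dy => F0 k y Dy)).
apply: le_trans (geometric_series_le M lam M0 lam01).
apply: lee_nneseries => [k _ _|k _]; first by apply: integral_ge0 => y; exact: F0.
have -> : (\int[leb]_(y in D) F k y = (a k)%:E *
    \int[leb]_(y in D) (\1_(eball x (r k) : set W) y : R)%:E)%E.
  have I0 y : D y -> (0 <= (\1_(eball x (r k) : set W) y : R)%:E)%E by rewrite lee_fin.
  exact: (ge0_integralZl_EFin leb mD I0 (mI k) (a0 k)).
rewrite (integral_indic leb mD (measurable_eball x (r k))).
apply: (@le_trans _ _ ((a k)%:E * ((2 * r k) ^+ N)%:E)%E); last by rewrite -EFinM lee_fin.
apply: lee_wpmul2l; first by rewrite lee_fin.
apply: le_trans (leb_eball_le x (r k) (r0 k)).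
by apply: le_outer_measure; exact: subIsetl.
Qed.

Lemma powR_geometric (t c b : R) (k : nat) : 0 <= t -> 0 <= c ->
  (t * c ^+ k) `^ b = t `^ b * (c `^ b) ^+ k.
Proof.
move=> t0 c0; rewrite powRM ?exprn_ge0//; congr (_ * _).
by rewrite -powR_mulrn// powRAC powR_mulrn// powR_ge0.
Qed.

Lemma powRN_anti (b t t' : R) : 0 <= b -> 0 < t -> t <= t' -> t' `^ (- b) <= t `^ (- b).
Proof.
move=> b0 t0 tt'; have t'0 := lt_le_trans t0 tt'.
rewrite !powRN lef_pV2 ?posrE ?powR_gt0//.
by apply: ge0_ler_powR => //; rewrite nnegrE ltW.
Qed.

Lemma lt_expr2 (t : R) : exists n, t < 2 ^+ n.
Proof.
have [n tn] : exists n : nat, t < n%:R.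
  exists (Num.bound `|t|); apply: le_lt_trans (ler_norm t) _.
  exact: archi_boundP.
by exists n; rewrite (lt_le_trans tn)// -natrX ler_nat ltnW// ltn_expl.
Qed.

Lemma dyadic_below (rho t : R) : 0 < t -> t < rho ->
  exists k, t < rho * 2^-1 ^+ k /\ rho * 2^-1 ^+ k * 2^-1 <= t.
Proof.
move=> t0 trho; pose P n := rho * 2^-1 ^+ n <= t.
have exP : exists n, P n.
  have [n nt] := lt_expr2 (rho / t); exists n; rewrite /P exprVn ler_pdivrMr ?exprn_gt0//.
  by rewrite mulrC -ler_pdivrMr// ltW.
case: (ex_minnP exP) => -[|k] Pk mink.
  by move: Pk; rewrite /P expr0 mulr1 leNgt trho.
exists k; split; last by rewrite -mulrA -exprSr.
by rewrite ltNge; apply/negP => /mink; rewrite ltnn.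
Qed.

Lemma dyadic_above (rho t : R) : 0 < rho -> rho <= t ->
  exists k, rho * 2 ^+ k <= t /\ t < rho * 2 ^+ k * 2.
Proof.
move=> rho0 trho; pose P n := t < rho * 2 ^+ n.
have exP : exists n, P n.
  have [n nt] := lt_expr2 (t / rho); exists n.
  by rewrite /P mulrC -ltr_pdivrMr.
case: (ex_minnP exP) => -[|k] Pk mink.
  by move: Pk; rewrite /P expr0 mulr1 ltNge trho.
exists k; split; last by rewrite -mulrA -exprSr.
by rewrite leNgt; apply/negP => /mink; rewrite ltnn.
Qed.

Variable s : R.
Hypothesis s01 : 0 < s < 1.
Local Notation q := (N%:R + 2 * s).

(** The radial profile of the kernels, as a function of the distance. *)
Definition kern (t : R) : R := t `^ (- q).

Lemma q_ge0 : 0 <= q.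
Proof. by case/andP: s01 => s0 _; rewrite addr_ge0// mulr_ge0// ltW. Qed.

Lemma kern_ge0 t : 0 <= kern t.
Proof. exact: powR_ge0. Qed.

Lemma kern_gt0 t : 0 < t -> 0 < kern t.
Proof. exact: powR_gt0. Qed.

Lemma kern_anti t t' : 0 < t -> t <= t' -> kern t' <= kern t.
Proof. by move=> t0 tt'; apply: powRN_anti => //; exact: q_ge0. Qed.

Lemma kernM t t' : 0 <= t -> 0 <= t' -> kern (t * t') = kern t * kern t'.
Proof. exact: powRM. Qed.

Lemma exprn_kern t : 0 < t -> t ^+ N * kern t = t `^ (- (2 * s)).
Proof.
move=> t0; rewrite -powR_mulrn ?ltW// -powRD; last by rewrite (gt_eqF t0) implybT.
by congr (_ `^ _); rewrite opprD addrA subrr add0r.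
Qed.

Lemma expr2n_kern t : 0 < t -> t ^+ 2 * t ^+ N * kern t = t `^ (2 - 2 * s).
Proof.
move=> t0; rewrite -mulrA exprn_kern// -powR_mulrn ?ltW// -powRD//.
by rewrite (gt_eqF t0) implybT.
Qed.

Lemma measurable_kern (x : V) :
  measurable_fun setT ((fun y => kern (enorm (y - x))) : W -> R).
Proof.
apply: (@measurableT_comp _ _ _ _ _ _ (fun t : R => t `^ (- q))).
  exact: measurable_powR.
exact: measurable_enorm.
Qed.

Lemma measurable_sqr_kern (x : V) :
  measurable_fun setT ((fun y => enorm (y - x) ^+ 2 * kern (enorm (y - x))) : W -> R).
Proof.
apply: measurable_funM; last exact: measurable_kern.
by apply: continuous_measurable_rV; exact: continuous_enorm_sqr.
Qed.

(** Up to constant factors, the sums of the geometric series over dyadic balls that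
    shrink to the centre, respectively grow to infinity. *)
Definition near_cst : R := kern 2^-1 * 2 ^+ N / (1 - 2^-1 `^ (2 - 2 * s)).
Definition far_cst : R := 4 ^+ N / (1 - 2 `^ (- (2 * s))).
Definition low_cst : R := kern (2 * N%:R).

Lemma near_ratio : 0 <= (2^-1 : R) `^ (2 - 2 * s) < 1.
Proof.
case/andP: s01 => s0 s1; rewrite powR_ge0/=.
have : (2^-1 : R) `^ (2 - 2 * s) < 1 `^ (2 - 2 * s).
  by apply: gt0_ltr_powR; rewrite ?nnegrE//; lra.
by rewrite powR1.
Qed.

Lemma far_ratio : 0 <= (2 : R) `^ (- (2 * s)) < 1.
Proof.
case/andP: s01 => s0 s1; rewrite powR_ge0/= powRN invf_lt1 ?powR_gt0//.
have : 1 `^ (2 * s) < (2 : R) `^ (2 * s).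
  by apply: gt0_ltr_powR; rewrite ?nnegrE//; lra.
by rewrite powR1.
Qed.

Lemma near_cst_ge0 : 0 <= near_cst.
Proof.
by rewrite divr_ge0 ?mulr_ge0 ?kern_ge0 ?exprn_ge0// subr_ge0 ltW//; case/andP: near_ratio.
Qed.

Lemma far_cst_ge0 : 0 <= far_cst.
Proof. by rewrite divr_ge0 ?exprn_ge0// subr_ge0 ltW//; case/andP: far_ratio. Qed.

Lemma measurable_annulus (x : V) (rho e : R) :
  measurable (eball x rho `\` eball x e : set W).
Proof. by apply: measurableD; exact: measurable_eball. Qed.

Lemma integral_near_kern (x : V) (rho e : R) : 0 < rho -> 0 < e ->
  (\int[leb]_(y in (eball x rho `\` eball x e : set W))
     (enorm (y - x) ^+ 2 * kern (enorm (y - x)))%:E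
   <= (near_cst * rho `^ (2 - 2 * s))%:E)%E.
Proof.
move=> rho0 e0.
have r_gt0 k : 0 < rho * 2^-1 ^+ k by rewrite mulr_gt0 ?exprn_gt0 ?invr_gt0.
have -> : near_cst * rho `^ (2 - 2 * s) =
    (kern 2^-1 * 2 ^+ N * rho `^ (2 - 2 * s)) / (1 - 2^-1 `^ (2 - 2 * s)).
  by rewrite /near_cst; ring.
apply: (@ge0_integral_le_balls _ _ x
  (fun k => (rho * 2^-1 ^+ k) ^+ 2 * (kern 2^-1 * kern (rho * 2^-1 ^+ k)))
  (fun k => rho * 2^-1 ^+ k)).
- exact: measurable_annulus.
- apply: measurable_funTS; exact: measurable_sqr_kern.
- by move=> y _; rewrite mulr_ge0 ?sqr_ge0 ?kern_ge0.
- by move=> k; rewrite mulr_ge0 ?sqr_ge0 ?mulr_ge0 ?kern_ge0.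
- by move=> k; exact: ltW.
- by rewrite !mulr_ge0 ?kern_ge0 ?powR_ge0 ?exprn_ge0.
- exact: near_ratio.
- move=> y [yrho /negP]; rewrite -leNgt => ye; have t0 := lt_le_trans e0 ye.
  have [k [tk kt]] := dyadic_below rho _ t0 yrho; exists k; split => //.
  apply: ler_pM; rewrite ?sqr_ge0 ?kern_ge0//.
    by rewrite ler_pXn2r ?nnegrE ?enorm_ge0// ltW.
  rewrite mulrC -(kernM _ _ (ltW (r_gt0 k))); last by rewrite invr_ge0.
  by apply: kern_anti => //; rewrite mulr_gt0 ?invr_gt0.
- move=> k; rewrite -[leRHS]mulrA -powR_geometric ?invr_ge0 ?(ltW rho0)//.
  move: (rho * 2^-1 ^+ k) (r_gt0 k) => t t0; rewrite -expr2n_kern// exprMn.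
  by rewrite le_eqVlt; apply/orP; left; apply/eqP; ring.
Qed.

Lemma integral_far_kern (x : V) (rho : R) : 0 < rho ->
  (\int[leb]_(y in (~` eball x rho : set W)) (kern (enorm (y - x)))%:E
   <= (far_cst * rho `^ (- (2 * s)))%:E)%E.
Proof.
move=> rho0.
have r_gt0 k : 0 < rho * 2 ^+ k by rewrite mulr_gt0 ?exprn_gt0.
have -> : far_cst * rho `^ (- (2 * s)) =
    (4 ^+ N * rho `^ (- (2 * s))) / (1 - 2 `^ (- (2 * s))).
  by rewrite /far_cst; ring.
apply: (@ge0_integral_le_balls _ _ x (fun k => kern (rho * 2 ^+ k))
  (fun k => rho * 2 ^+ k * 2)).
- by apply: measurableC; exact: measurable_eball.
- apply: measurable_funTS; exact: measurable_kern.
- by move=> y _; rewrite kern_ge0.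
- by move=> k; rewrite kern_ge0.
- by move=> k; rewrite mulr_ge0// ltW.
- by rewrite !mulr_ge0 ?powR_ge0 ?exprn_ge0.
- exact: far_ratio.
- move=> y /negP; rewrite -leNgt => ye.
  have [k [kt tk]] := dyadic_above rho _ rho0 ye; exists k; split => //.
  by apply: kern_anti.
- move=> k; rewrite -[leRHS]mulrA -powR_geometric ?(ltW rho0)//.
  move: (rho * 2 ^+ k) (r_gt0 k) => t t0; rewrite -exprn_kern//.
  rewrite (_ : 2 * (t * 2) = 4 * t); last by ring.
  by rewrite exprMn le_eqVlt; apply/orP; left; apply/eqP; ring.
Qed.

(** The shell outside the ball of radius [rho] contains a cube of side [rho] at
    distance at most [2 * N * rho], on which the profile is bounded below. *)
Lemma integral_far_kern_ge (x : V) (rho : R) : (0 < N)%N -> 0 < rho ->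
  ((low_cst * rho `^ (- (2 * s)))%:E <=
   \int[leb]_(y in (~` eball x rho : set W)) (kern (enorm (y - x)))%:E)%E.
Proof.
move=> N0 rho0.
pose x' : V := \row_i (x ord0 i + rho).
pose Q : set W := box (x', \row_i (x' ord0 i + rho)).
have mQ : measurable Q by exact: box_measurable.
have Qy y : Q y -> rho <= enorm (y - x) <= (2 * N%:R) * rho.
  move=> Qy; have Qi i : rho <= (y - x) ord0 i <= 2 * rho.
    by have := Qy i; rewrite !mxE => /andP[h1 h2]; apply/andP; split; lra.
  apply/andP; split.
    have /andP[h1 _] := Qi (Ordinal N0).
    by apply: le_trans h1 _; apply: le_trans (ler_norm _) (coord_le_enorm _ _).
  rewrite -mulrA mulrCA; apply: enorm_le_coord => [|i]; first by rewrite mulr_ge0// ltW.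
  have /andP[h1 h2] := Qi i; rewrite ger0_norm//; exact: le_trans (ltW rho0) h1.
have QB : Q `<=` ~` eball x rho.
  by move=> y /Qy /andP[h _]; rewrite /eball/=; apply/negP; rewrite -leNgt.
have mB : measurable (~` eball x rho : set W) by apply: measurableC; exact: measurable_eball.
have mk (D : set W) : measurable_fun D (fun y : W => (kern (enorm (y - x)))%:E).
  by apply/measurable_EFinP; apply: measurable_funTS; exact: measurable_kern.
apply: (@le_trans _ _ (\int[leb]_(y in Q) (kern (enorm (y - x)))%:E)%E); last first.
  apply: ge0_subset_integral; [exact: mQ|exact: mB|exact: mk| |exact: QB].
  by move=> y _; rewrite lee_fin kern_ge0.
apply: (@le_trans _ _ (\int[leb]_(y in Q) (kern (2 * N%:R * rho))%:E)%E); last first.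
  apply: ge0_le_integral; first exact: mQ.
  - by move=> y _; rewrite lee_fin kern_ge0.
  - exact: measurable_cst.
  - exact: mk.
  - move=> y /Qy/andP[h1 h2]; rewrite lee_fin; apply: kern_anti => //.
    exact: lt_le_trans h1.
rewrite integral_cst// -exprn_kern// kernM; [|by rewrite mulr_ge0|exact: ltW].
rewrite /low_cst (_ : _ * (_ * _) = kern (2 * N%:R) * kern rho * rho ^+ N); last by ring.
rewrite [X in (X <= _)%E]EFinM; apply: lee_wpmul2l.
  by rewrite lee_fin mulr_ge0 ?kern_ge0.
exact: (leb_outer_cube_ge x' rho (ltW rho0)).
Qed.

End PowerIntegrals.

(** * Integrals of real-valued functions *)

Section RealIntegrals.
Context {R : realType} {N : nat}.
Local Notation V := 'rV[R]_N.
Local Notation W := (lebesgue_rV R N).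
Implicit Types (D : set W) (f h : W -> R).

Definition integ D f := leb.-integrable D (EFin \o f).
Definition intR D f : R := \int[leb]_(y in D) f y.

Lemma intRE D f : measurable D -> integ D f ->
  (\int[leb]_(y in D) (f y)%:E = (intR D f)%:E)%E.
Proof. by move=> mD fi; rewrite /intR /Rintegral fineK//; exact: integrable_fin_num. Qed.

Lemma integ_measurable D f : integ D f -> measurable_fun D f.
Proof. by move=> /measurable_int /measurable_EFinP. Qed.

Lemma integ_le D f h : measurable D -> measurable_fun D f -> integ D h ->
  (forall y, D y -> `|f y| <= h y) -> integ D f.
Proof.
move=> mD mf hi fh; apply: (le_integrable mD _ _ hi); first exact/measurable_EFinP.
move=> y Dy /=; rewrite lee_fin; exact: le_trans (fh y Dy) (ler_norm _).
Qed.

Lemma integ_ge0_bound D f (c : R) : measurable D -> measurable_fun D f ->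
  (forall y, D y -> 0 <= f y) -> (\int[leb]_(y in D) (f y)%:E <= c%:E)%E ->
  integ D f /\ intR D f <= c.
Proof.
move=> mD mf f0 fc.
have fi : integ D f.
  apply/integrableP; split; first exact/measurable_EFinP.
  apply: le_lt_trans (ltry c); apply: le_trans fc; apply: ge0_le_integral; first exact: mD.
  - by move=> y _; exact: abse_ge0.
  - by apply: measurableT_comp; [exact: abse_measurable|exact/measurable_EFinP].
  - exact/measurable_EFinP.
  - by move=> y Dy; rewrite /= lee_fin ger0_norm ?f0.
by split => //; rewrite -lee_fin -intRE.
Qed.

Lemma integS D D' f : measurable D -> measurable D' -> D' `<=` D -> integ D f -> integ D' f.
Proof. by move=> mD mD' DD' fi; exact: (integrableS mD mD' DD' fi). Qed.

Lemma integD D f h : measurable D -> integ D f -> integ D h -> integ D (fun y => f y + h y).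
Proof.
move=> mD fi hi; have := integrableD mD fi hi.
by apply: eq_integrable => // y _; rewrite /= EFinD.
Qed.

Lemma integZ D f (k : R) : measurable D -> integ D f -> integ D (fun y => k * f y).
Proof.
move=> mD fi; have := integrableZl mD k fi.
by apply: eq_integrable => // y _; rewrite /= EFinM.
Qed.

Lemma integB D f h : measurable D -> integ D f -> integ D h -> integ D (fun y => f y - h y).
Proof.
move=> mD fi hi; apply: (integD D f (fun y => - h y)) => //.
have := integZ D h (-1) mD hi.
by apply: eq_integrable => // y _; rewrite /= mulN1r.
Qed.

Lemma intRD D f h : measurable D -> integ D f -> integ D h ->
  intR D (fun y => f y + h y) = intR D f + intR D h.
Proof. by move=> mD fi hi; rewrite /intR RintegralD. Qed.

Lemma intRB D f h : measurable D -> integ D f -> integ D h ->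
  intR D (fun y => f y - h y) = intR D f - intR D h.
Proof. by move=> mD fi hi; rewrite /intR RintegralB. Qed.

Lemma intRZ D f (k : R) : measurable D -> integ D f ->
  intR D (fun y => k * f y) = k * intR D f.
Proof. by move=> mD fi; rewrite /intR RintegralZl. Qed.

Lemma le_intR D f h : measurable D -> integ D f -> integ D h ->
  (forall y, D y -> f y <= h y) -> intR D f <= intR D h.
Proof. by move=> mD fi hi fh; apply: le_Rintegral. Qed.

Lemma intR_ge0 D f : (forall y, D y -> 0 <= f y) -> 0 <= intR D f.
Proof. by move=> f0; exact: Rintegral_ge0. Qed.

Lemma intR_subset D D' f : measurable D -> measurable D' -> D' `<=` D -> integ D f ->
  (forall y, D y -> 0 <= f y) -> intR D' f <= intR D f.
Proof.
move=> mD mD' DD' fi f0; have f'i := integS _ _ _ mD mD' DD' fi.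
rewrite -lee_fin -!intRE//; apply: ge0_subset_integral; first exact: mD'.
- exact: mD.
- by apply/measurable_EFinP; exact: integ_measurable.
- by move=> y Dy; rewrite lee_fin f0.
- exact: DD'.
Qed.

Lemma intR_setU D D' f : measurable D -> measurable D' -> D `&` D' = set0 ->
  integ (D `|` D') f -> intR (D `|` D') f = intR D f + intR D' f.
Proof.
move=> mD mD' DD' fi; rewrite /intR Rintegral_setU//.
by apply/disj_setPS; rewrite DD'.
Qed.

(** The equation for a supersolution bounds an integral that could a priori be
    [+oo]: its negative part being finite, the bound makes its positive part
    finite too. *)
Lemma integ_of_lower D f h (c : R) : measurable D -> measurable_fun D f -> integ D h ->
  (forall y, D y -> - h y <= f y) -> (\int[leb]_(y in D) (f y)%:E <= c%:E)%E ->
  integ D f /\ intR D f <= c.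
Proof.
move=> mD mf hi hf fc.
have mF : measurable_fun D (EFin \o f) by exact/measurable_EFinP.
have mP := measurable_funepos mF; have mM := measurable_funeneg mF.
have ni : (\int[leb]_(y in D) (EFin \o f)^\- y < +oo)%E.
  have /integrableP[mh] := hi; apply: le_lt_trans; apply: ge0_le_integral.
  - exact: mD.
  - by move=> y _; exact: funeneg_ge0.
  - exact: mM.
  - by apply: measurableT_comp; [exact: abse_measurable|exact: mh].
  - move=> y Dy; rewrite funenegE ge_max abse_ge0 andbT /= lee_fin.
    by apply: le_trans (ler_norm _); rewrite lerNl hf.
have n0 : (0 <= \int[leb]_(y in D) (EFin \o f)^\- y)%E.
  by apply: integral_ge0 => y _; exact: funeneg_ge0.
have pi : (\int[leb]_(y in D) (EFin \o f)^\+ y < +oo)%E.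
  rewrite ltNge leye_eq; apply/negP => /eqP poo; move: fc.
  rewrite integralE poo; move: n0 ni.
  by case: (\int[leb]_(y in D) (EFin \o f)^\- y)%E => [r| |].
have fi : integ D f.
  apply/integrableP; split => //.
  rewrite (_ : (fun x => `|(EFin \o f) x|)%E = ((EFin \o f)^\+ \+ (EFin \o f)^\-)%E); last first.
    by rewrite -fune_abse.
  rewrite ge0_integralD; [exact: lte_add_pinfty|exact: mD|..].
  - by move=> y _; exact: funepos_ge0.
  - exact: mP.
  - by move=> y _; exact: funeneg_ge0.
  - exact: mM.
by split => //; rewrite -lee_fin -intRE.
Qed.

End RealIntegrals.

(** * The operators near and far from a point *)

Section KernelEstimates.
Context {R : realType} {N : nat}.
Local Notation V := 'rV[R]_N.
Local Notation W := (lebesgue_rV R N).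
Variables (gamma Gamma s : R) (K : V -> R) (x0 : V).
Hypotheses (gamma0 : 0 < gamma) (gG : gamma <= Gamma) (s01 : 0 < s < 1).
Hypothesis hK : kernel_class gamma Gamma s K.
Local Notation kern := (@kern R N s).
Local Notation near_cst := (@near_cst R N s).
Local Notation far_cst := (@far_cst R N s).
Local Notation low_cst := (@low_cst R N s).

Lemma Gamma_gt0 : 0 < Gamma. Proof. exact: lt_le_trans gG. Qed.

Lemma kernel_bounds (y : V) : 0 < enorm (y - x0) ->
  gamma * kern (enorm (y - x0)) <= K (x0 - y) <= Gamma * kern (enorm (y - x0)).
Proof.
move=> yx0; have [_ _ h] := hK; rewrite enorm_distC; apply: h.
by apply/eqP => e; move: yx0; rewrite enorm_distC e enorm0 ltxx.
Qed.

Lemma kernel_ge0 (y : V) : 0 < enorm (y - x0) -> 0 <= K (x0 - y).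
Proof.
move=> /kernel_bounds/andP[h _]; apply: le_trans h.
by rewrite mulr_ge0 ?kern_ge0// ltW.
Qed.

Lemma measurable_kernel_at : measurable_fun setT ((fun y => K (x0 - y)) : W -> R).
Proof.
have [mK _ _] := hK.
exact: (measurableT_comp mK (measurable_reflect_at x0)).
Qed.

Lemma measurable_far (rho : R) : measurable (~` eball x0 rho : set W).
Proof. by apply: measurableC; exact: measurable_eball. Qed.

Lemma far_enorm (rho : R) (y : V) : (~` eball x0 rho) y -> rho <= enorm (y - x0).
Proof. by move=> /negP; rewrite -leNgt. Qed.

Lemma annulus_enorm (rho e : R) (y : V) : (eball x0 rho `\` eball x0 e) y ->
  e <= enorm (y - x0) < rho.
Proof. by move=> [h1 /negP]; rewrite -leNgt => ->. Qed.

Lemma far_kern_integ (rho : R) : 0 < rho ->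
  integ (~` eball x0 rho) (fun y : W => kern (enorm (y - x0))) /\
  intR (~` eball x0 rho) (fun y : W => kern (enorm (y - x0))) <= far_cst * rho `^ (- (2 * s)).
Proof.
move=> rho0; apply: integ_ge0_bound.
- exact: measurable_far.
- by apply: measurable_funTS; exact: measurable_kern.
- by move=> y _; exact: kern_ge0.
- exact: integral_far_kern.
Qed.

Lemma far_kern_ge (rho : R) : (0 < N)%N -> 0 < rho ->
  low_cst * rho `^ (- (2 * s)) <= intR (~` eball x0 rho) (fun y : W => kern (enorm (y - x0))).
Proof.
move=> N0 rho0; have [fi _] := far_kern_integ rho rho0.
by rewrite -lee_fin -(intRE _ _ (measurable_far rho) fi); exact: integral_far_kern_ge.
Qed.

Lemma far_kernel_integ (rho : R) : 0 < rho ->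
  integ (~` eball x0 rho) (fun y : W => K (x0 - y)).
Proof.
move=> rho0; have mB := measurable_far rho.
apply: (integ_le _ _ _ mB _ (integZ _ _ Gamma mB (far_kern_integ rho rho0).1)).
  by apply: measurable_funTS; exact: measurable_kernel_at.
move=> y /far_enorm yrho; have y0 := lt_le_trans rho0 yrho.
by rewrite ger0_norm ?kernel_ge0//; have /andP[] := kernel_bounds y y0.
Qed.

Definition sqK (y : W) : R := enorm (y - x0) ^+ 2 * K (x0 - y).

Lemma near_sqK (rho e : R) : 0 < rho -> 0 < e ->
  integ (eball x0 rho `\` eball x0 e) sqK /\
  0 <= intR (eball x0 rho `\` eball x0 e) sqK <= Gamma * (near_cst * rho `^ (2 - 2 * s)).
Proof.
move=> rho0 e0; have mA := measurable_annulus x0 rho e.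
have [ki kb] : integ (eball x0 rho `\` eball x0 e)
      (fun y : W => enorm (y - x0) ^+ 2 * kern (enorm (y - x0))) /\
   intR (eball x0 rho `\` eball x0 e)
      (fun y : W => enorm (y - x0) ^+ 2 * kern (enorm (y - x0)))
    <= near_cst * rho `^ (2 - 2 * s).
  apply: integ_ge0_bound.
  - exact: mA.
  - by apply: measurable_funTS; exact: measurable_sqr_kern.
  - by move=> y _; rewrite mulr_ge0 ?sqr_ge0 ?kern_ge0.
  - exact: integral_near_kern.
have b y : (eball x0 rho `\` eball x0 e) y ->
    0 <= sqK y <= Gamma * (enorm (y - x0) ^+ 2 * kern (enorm (y - x0))).
  move=> /annulus_enorm/andP[ye _]; have y0 := lt_le_trans e0 ye.
  rewrite /sqK mulr_ge0 ?sqr_ge0 ?kernel_ge0//= mulrCA ler_wpM2l ?sqr_ge0//.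
  by have /andP[] := kernel_bounds y y0.
have Gki := integZ _ _ Gamma mA ki.
have si : integ (eball x0 rho `\` eball x0 e) sqK.
  apply: (integ_le _ _ _ mA _ Gki).
    apply: measurable_funTS; apply: measurable_funM; last exact: measurable_kernel_at.
    by apply: continuous_measurable_rV; exact: continuous_enorm_sqr.
  by move=> y /b/andP[h1 h2]; rewrite ger0_norm.
split => //; apply/andP; split; first by apply: intR_ge0 => y /b/andP[].
apply: (@le_trans _ _ (intR (eball x0 rho `\` eball x0 e)
   (fun y : W => Gamma * (enorm (y - x0) ^+ 2 * kern (enorm (y - x0)))))).
  by apply: le_intR => // y /b/andP[].
by rewrite intRZ// ler_wpM2l// ltW// Gamma_gt0.
Qed.

Lemma dot_expand (a y : V) :
  dot a (y - x0) = (enorm (y - (x0 - a)) ^+ 2 - enorm a ^+ 2 - enorm (y - x0) ^+ 2) / 2.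
Proof.
have -> : y - (x0 - a) = a + (y - x0) by rewrite opprB addrCA.
by rewrite enormD_sqr; field.
Qed.

Lemma measurable_dot (a : V) : measurable_fun setT ((fun y => dot a (y - x0)) : W -> R).
Proof.
rewrite (_ : (fun _ => _) = (fun y : W => (enorm (y - (x0 - a)) ^+ 2 - enorm a ^+ 2 - enorm (y - x0) ^+ 2) / 2)).
  apply: measurable_funM; last exact: measurable_cst.
  apply: measurable_funB; first apply: measurable_funB; [|exact: measurable_cst|].
    by apply: continuous_measurable_rV; exact: continuous_enorm_sqr.
  by apply: continuous_measurable_rV; exact: continuous_enorm_sqr.
by apply/funext => y; rewrite dot_expand.
Qed.

Lemma dot_le (a y : V) : `|dot a y| <= enorm a * enorm y.
Proof.
rewrite -(@ler_pXn2r _ 2)// ?nnegrE ?mulr_ge0 ?enorm_ge0//.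
by rewrite real_normK ?num_real// exprMn dot_sqr_le.
Qed.

(** The kernel is even and the linear function is odd about the centre.  The
    integrability comes from [|dot a (y - x0)| <= (|a| / e) * |y - x0| ^+ 2] on the
    annulus. *)
Lemma near_linear (rho e : R) (a : V) : 0 < rho -> 0 < e ->
  integ (eball x0 rho `\` eball x0 e) (fun y : W => dot a (y - x0) * K (x0 - y)) /\
  intR (eball x0 rho `\` eball x0 e) (fun y : W => dot a (y - x0) * K (x0 - y)) = 0.
Proof.
move=> rho0 e0; have mA := measurable_annulus x0 rho e.
have [si _] := near_sqK rho e rho0 e0.
have mf : measurable_fun setT ((fun y => dot a (y - x0) * K (x0 - y)) : W -> R).
  by apply: measurable_funM; [exact: measurable_dot|exact: measurable_kernel_at].
have li : integ (eball x0 rho `\` eball x0 e) (fun y : W => dot a (y - x0) * K (x0 - y)).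
  apply: (integ_le _ _ _ mA _ (integZ _ _ (enorm a / e) mA si)).
    exact: measurable_funTS.
  move=> y /annulus_enorm/andP[ye _]; have y0 := lt_le_trans e0 ye.
  rewrite normrM (ger0_norm (kernel_ge0 y y0)) /sqK mulrA.
  rewrite ler_wpM2r ?kernel_ge0//; apply: le_trans (dot_le _ _) _.
  rewrite -mulrA ler_wpM2l ?enorm_ge0// mulrC ler_pdivlMr// expr2.
  by rewrite ler_wpM2l// ltW.
split => //; apply: EFin_inj; rewrite -intRE//.
have refl (y : V) : reflect_at (x0 + x0) y - x0 = - (y - x0).
  by rewrite /reflect_at opprB addrAC addrK.
apply: (@integral_odd_reflect R N (x0 + x0)) => //.
  by move=> y [h1 h2]; split; rewrite /eball/= refl enormN.
move=> y; rewrite refl -[x0 - reflect_at _ _]opprB refl opprK.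
have [_ ev _] := hK; rewrite (_ : K (y - x0) = K (x0 - y)).
  by rewrite (_ : dot a (- (y - x0)) = - dot a (y - x0)) ?mulNr// /dot -sumrN;
    apply: eq_bigr => i _; rewrite !mxE mulrN.
by rewrite ev opprB.
Qed.

Lemma near_paraboloid (b : R) (z : V) (rho e : R) : 0 < rho -> 0 < e ->
  let phi := paraboloid b z x0 rho in
  integ (eball x0 rho `\` eball x0 e) (fun y : W => (phi y - phi x0) * K (x0 - y)) /\
  intR (eball x0 rho `\` eball x0 e) (fun y : W => (phi y - phi x0) * K (x0 - y)) =
    b * intR (eball x0 rho `\` eball x0 e) sqK.
Proof.
move=> rho0 e0 phi; have mA := measurable_annulus x0 rho e.
have [si _] := near_sqK rho e rho0 e0.
have [li l0] := near_linear rho e (x0 - z) rho0 e0.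
have li2 := integZ _ _ (2 * b) mA li; have si2 := integZ _ _ b mA si.
have E (y : W) : (eball x0 rho `\` eball x0 e) y -> (phi y - phi x0) * K (x0 - y) =
    2 * b * (dot (x0 - z) (y - x0) * K (x0 - y)) + b * sqK y.
  by move=> [yb _]; rewrite /phi paraboloid_expand// /sqK; ring.
split.
  have := integD _ _ _ mA li2 si2.
  by apply: eq_integrable => // y; rewrite inE => /E /= ->.
transitivity (intR (eball x0 rho `\` eball x0 e) (fun y : W =>
   2 * b * (dot (x0 - z) (y - x0) * K (x0 - y)) + b * sqK y)).
  by apply: eq_Rintegral => y; rewrite inE => /E.
by rewrite intRD// !intRZ// l0 mulr0 add0r.
Qed.

(** The principal value exists because the integrals over the annuli are [b]
    times a monotone bounded function of the inner radius. *)
Lemma LK_paraboloid (b : R) (z : V) (rho : R) : 0 < rho ->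
  exists m : R, 0 <= m <= Gamma * (near_cst * rho `^ (2 - 2 * s)) /\
    LK K (eball x0 rho) (paraboloid b z x0 rho) x0 = (b * m)%:E.
Proof.
move=> rho0; pose phi := paraboloid b z x0 rho.
pose F (e : R) : \bar R := (\int[leb]_(y in (eball x0 rho `\` eball x0 e : set W)) (sqK y)%:E)%E.
have FE e : 0 < e -> F e = (intR (eball x0 rho `\` eball x0 e) sqK)%:E.
  move=> e0; rewrite /F intRE//; first exact: measurable_annulus.
  exact: (near_sqK rho e rho0 e0).1.
have Fb e : 0 < e -> (0 <= F e <= (Gamma * (near_cst * rho `^ (2 - 2 * s)))%:E)%E.
  by move=> e0; rewrite FE// !lee_fin; exact: (near_sqK rho e rho0 e0).2.
have Fni : {in Interval (BRight 0) (BInfty R false) &, nonincreasing_fun F}.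
  move=> e e'; rewrite !in_itv/= !andbT => e0 e'0 ee'.
  rewrite !FE// lee_fin; apply: intR_subset.
  - exact: measurable_annulus.
  - exact: measurable_annulus.
  - move=> y [h1 h2]; split => // h3; apply: h2; exact: lt_le_trans h3 ee'.
  - exact: (near_sqK rho e rho0 e0).1.
  - move=> y /annulus_enorm/andP[ye _].
    by rewrite /sqK mulr_ge0 ?sqr_ge0// kernel_ge0// (lt_le_trans e0 ye).
have cF := nonincreasing_at_right_cvge (BInfty R false) isT Fni.
set S := ereal_sup _ in cF.
have Sb : (0 <= S <= (Gamma * (near_cst * rho `^ (2 - 2 * s)))%:E)%E.
  apply/andP; split.
    apply: le_ereal_sup_tmp; exists (F 1); last by have /andP[] := Fb 1 ltr01.
    by exists 1 => //=; rewrite in_itv/= ltr01.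
  apply: ge_ereal_sup => x [e /=]; rewrite in_itv/= andbT => e0 <-.
  by have /andP[] := Fb e e0.
have [m Sm] : exists m, S = m%:E.
  by move: Sb; case: S {cF} => [m| |]/andP[] // _ _; exists m.
exists m; split; first by move: Sb; rewrite Sm !lee_fin.
rewrite /LK; apply: cvg_lim => //; rewrite EFinM -Sm.
have := cvgeZl (isT : b%:E \is a fin_num) cF; apply: cvg_trans; apply: near_eq_cvg.
near=> e; have e0 : 0 < e by near: e; exact: nbhs_right_gt.
have [pi pE] := near_paraboloid b z rho e rho0 e0.
rewrite FE// -EFinM -pE -intRE//; exact: measurable_annulus.
Unshelve. all: by end_near. Qed.

(** The excised balls do not meet the far region once their radius is below
    [rho]. *)
Lemma LK_far (u : V -> R) (rho : R) : 0 < rho ->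
  LK K (~` eball x0 rho) u x0 =
  (\int[leb]_(y in (~` eball x0 rho : set W)) ((u y - u x0) * K (x0 - y))%:E)%E.
Proof.
move=> rho0; rewrite /LK; apply: cvg_lim => //; apply: cvg_near_cst; near=> e.
rewrite (_ : ~` eball x0 rho `\` eball x0 e = ~` eball x0 rho)//.
apply/seteqP; split => y; first by case.
move=> yr; split => // ye; apply: yr; apply: lt_trans ye _.
by near: e; exact: nbhs_right_lt.
Unshelve. all: by end_near. Qed.

End KernelEstimates.

(** * Integral estimates at contact points *)

Section ContactEstimates.
Context {R : realType} {N : nat}.
Local Notation V := 'rV[R]_N.
Local Notation W := (lebesgue_rV R N).
Variables (gamma Gamma s : R) (K : V -> R).
Hypotheses (gamma0 : 0 < gamma) (gG : gamma <= Gamma) (s01 : 0 < s < 1).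
Hypothesis hK : kernel_class gamma Gamma s K.
Local Notation kern := (@kern R N s).
Local Notation near_cst := (@near_cst R N s).
Local Notation far_cst := (@far_cst R N s).
Local Notation low_cst := (@low_cst R N s).

(** The profile around [x], capped inside the ball of radius [r], where the
    contact argument at [x] gives no more than local integrability of [u]. *)
Definition tail_weight (r : R) (x y : V) : R := kern (Num.max r (enorm (y - x))).

Definition tail_cst (r : R) : R := kern r * (2 * r) ^+ N + far_cst * r `^ (- (2 * s)).

Lemma tail_weight_ge0 r x y : 0 <= tail_weight r x y.
Proof. exact: kern_ge0. Qed.

Lemma measurable_tail_weight r x : measurable_fun setT (tail_weight r x : W -> R).
Proof.
apply: (@measurableT_comp _ _ _ _ _ _ (fun t : R => kern t)).
  exact: measurable_powR.
apply: (@measurable_maxr _ _ _ setT (cst r) (fun y : W => enorm (y - x))).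
  exact: measurable_cst.
exact: measurable_enorm.
Qed.

Lemma integral_split_eball (x : V) (r : R) (f : W -> R) : measurable_fun setT f ->
  (forall y, 0 <= f y) ->
  (\int[leb]_(y in setT) (f y)%:E = \int[leb]_(y in (eball x r : set W)) (f y)%:E +
     \int[leb]_(y in (~` eball x r : set W)) (f y)%:E)%E.
Proof.
move=> mf f0; rewrite -(setUv (eball x r)); apply: ge0_integral_setU.
- exact: measurable_eball.
- exact: measurable_far.
- by apply: measurable_funTS; exact/measurable_EFinP.
- by move=> y _; rewrite lee_fin.
- by apply/disj_setPS; rewrite setICr.
Qed.

Lemma integral_eball_le (x : V) (r : R) (f : W -> R) (c : R) : 0 <= r -> 0 <= c ->
  measurable_fun setT f -> (forall y, 0 <= f y) -> (forall y, eball x r y -> f y <= c) ->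
  (\int[leb]_(y in (eball x r : set W)) (f y)%:E <= (c * (2 * r) ^+ N)%:E)%E.
Proof.
move=> r0 c0 mf f0 fc.
apply: (@le_trans _ _ (\int[leb]_(y in (eball x r : set W)) c%:E)%E).
  apply: ge0_le_integral; first exact: measurable_eball.
  - by move=> y _; rewrite lee_fin.
  - by apply: measurable_funTS; exact/measurable_EFinP.
  - exact: measurable_cst.
  - by move=> y yB; rewrite lee_fin fc.
rewrite integral_cst; last exact: measurable_eball.
rewrite [leRHS]EFinM; apply: lee_wpmul2l; first by rewrite lee_fin.
exact: leb_eball_le.
Qed.

Lemma tail_weight_integ (r : R) (x : V) : 0 < r ->
  integ setT (tail_weight r x) /\ intR setT (tail_weight r x) <= tail_cst r.
Proof.
move=> r0; have mw := measurable_tail_weight r x.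
have w0 := tail_weight_ge0 r x.
apply: integ_ge0_bound => //.
rewrite (integral_split_eball x r)// EFinD; apply: leeD.
  apply: integral_eball_le => //; [exact: ltW|exact: kern_ge0|].
  by move=> y yB; apply: (kern_anti _ s01) => //; rewrite le_max lexx.
apply: le_trans (integral_far_kern _ s01 x r r0).
rewrite le_eqVlt; apply/orP; left; apply/eqP; apply: eq_integral => y.
by rewrite inE => /far_enorm yr; rewrite /tail_weight (max_idPr yr).
Qed.

(** Contact from below at [x1].  Outside the contact ball, [(u - u x1) * K]
    dominates [gamma * w * u] up to [Gamma * M * w], where [w] is the weight.
    Inside it [u - u x1] may be negative with a nonintegrable kernel, so the
    paraboloid is subtracted first: what remains is nonnegative and at least
    [u - 2 * M], and the paraboloid itself has a controlled integral on annuli.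
    The bound is uniform in the radius [rho] of the excised ball. *)
Lemma tail_le_of_contact (u : V -> R) (x1 z : V) (rho1 rho A M B : R) :
  continuous u -> (forall y, 0 <= u y) ->
  0 < rho -> rho < rho1 -> 0 <= A -> u x1 <= M -> A * enorm (x1 - z) ^+ 2 <= M ->
  (forall y, eball x1 rho1 y -> u x1 + A * enorm (x1 - z) ^+ 2 <= u y + A * enorm (y - z) ^+ 2) ->
  (\int[leb]_(y in (~` eball x1 rho : set W)) ((u y - u x1) * K (x1 - y))%:E <= B%:E)%E ->
  (\int[leb]_(y in (~` eball x1 rho : set W)) (gamma * (tail_weight rho1 x1 y * u y))%:E
    <= (B + A * (Gamma * (near_cst * rho1 `^ (2 - 2 * s))) +
        (2 * gamma + Gamma) * M * tail_cst rho1)%:E)%E.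
Proof.
move=> cu u0 rho0 rhorho1 A0 uM AM touch hB.
have rho10 := lt_trans rho0 rhorho1; have M0 := le_trans (u0 x1) uM.
have G0 := lt_le_trans gamma0 gG.
pose P : set W := ~` eball x1 rho; pose Ann : set W := eball x1 rho1 `\` eball x1 rho.
pose Far : set W := ~` eball x1 rho1.
have mP : measurable P := measurable_far x1 rho.
have mAnn : measurable Ann := measurable_annulus x1 rho1 rho.
have mFar : measurable Far := measurable_far x1 rho1.
have PE : P = Ann `|` Far.
  apply/seteqP; split => y.
    by move=> Py; have [yb|nyb] := pselect (eball x1 rho1 y); [left|right].
  by case=> [[]//|yF yb]; apply: yF; exact: lt_trans yb rhorho1.
have AF : Ann `&` Far = set0 by apply/seteqP; split => // y [[? ?]].
have AP : Ann `<=` P by rewrite PE; exact: subsetUl.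
have FP : Far `<=` P by rewrite PE; exact: subsetUr.
pose w : W -> R := tail_weight rho1 x1.
have w0 y : 0 <= w y by exact: tail_weight_ge0.
have [wi wb] := tail_weight_integ rho1 x1 rho10.
have wAnn : integ Ann w by apply: (integS _ _ _ _ _ _ wi) => //; exact: measurableT.
have wFar : integ Far w by apply: (integS _ _ _ _ _ _ wi) => //; exact: measurableT.
have mu : measurable_fun setT (u : W -> R) by exact: continuous_measurable_rV.
have mK := measurable_kernel_at _ _ _ _ x1 hK.
pose h (y : W) := (u y - u x1) * K (x1 - y).
have mh : measurable_fun setT h.
  apply: measurable_funM; last exact: mK.
  by apply: measurable_funB; [exact: mu|exact: measurable_cst].
have Ki := far_kernel_integ _ _ _ _ x1 gamma0 s01 hK rho rho0.
have [hi hb] : integ P h /\ intR P h <= B.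
  apply: (integ_of_lower _ _ _ _ mP _ (integZ _ _ (u x1) mP Ki)) => //.
    exact: measurable_funTS.
  move=> y /far_enorm yr; have y0 := lt_le_trans rho0 yr.
  rewrite -mulNr ler_wpM2r ?(kernel_ge0 _ _ _ _ _ gamma0 hK)// lerBrDr addrC subrr.
  exact: u0.
have hAnn : integ Ann h by exact: (integS _ _ _ mP _ _ hi).
have hFar : integ Far h by exact: (integS _ _ _ mP _ _ hi).
have hE : intR P h = intR Ann h + intR Far h by rewrite PE intR_setU// -PE.
pose phi := paraboloid (- A) z x1 rho1.
have [ki kE] := near_paraboloid _ _ _ _ x1 gamma0 gG s01 hK (- A) z rho1 rho rho10 rho0.
rewrite -/phi in ki kE.
have [_ /andP[_ sb]] := near_sqK _ _ _ _ x1 gamma0 gG s01 hK rho1 rho rho10 rho0.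
set I2 := intR _ (sqK _ _) in sb kE.
pose k (y : W) := (phi y - phi x1) * K (x1 - y).
have kb : - (A * (Gamma * (near_cst * rho1 `^ (2 - 2 * s)))) <= intR Ann k.
  by rewrite [intR Ann k]kE mulNr lerN2 ler_wpM2l.
pose U (y : W) := gamma * (w y * u y).
have U0 y : 0 <= U y by rewrite !mulr_ge0// ltW.
have mU : measurable_fun setT U.
  apply: measurable_funM; first exact: measurable_cst.
  by apply: measurable_funM; [exact: measurable_tail_weight|exact: mu].
have UAnn y : Ann y -> U y <= (h y - k y) + 2 * gamma * M * w y.
  move=> Ay; have /andP[yr _] := annulus_enorm _ _ _ _ Ay; have y0 := lt_le_trans rho0 yr.
  have yb : eball x1 rho1 y by case: Ay.
  have /andP[K1 _] := kernel_bounds _ _ _ _ _ hK y y0.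
  have wk : w y <= kern (enorm (y - x1)).
    by apply: (kern_anti _ s01) => //; rewrite le_max lexx orbT.
  have phx : phi x1 = - A * enorm (x1 - z) ^+ 2 by rewrite /phi paraboloidE//; exact: eball_center.
  have phy : phi y = - A * enorm (y - z) ^+ 2 by rewrite /phi paraboloidE.
  have hk : h y - k y = (u y + A * enorm (y - z) ^+ 2 - (u x1 + A * enorm (x1 - z) ^+ 2)) * K (x1 - y).
    by rewrite /h /k phx phy; ring.
  have t0 := touch y yb.
  have Ay0 : 0 <= A * enorm (y - z) ^+ 2 by rewrite mulr_ge0 ?sqr_ge0.
  move: (enorm (y - z) ^+ 2) (enorm (x1 - z) ^+ 2) AM hk t0 Ay0 => a b AM -> t0 Ay0.
  apply: (@le_trans _ _ ((u y + A * a - (u x1 + A * b)) * (gamma * w y) + 2 * gamma * M * w y)).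
    rewrite -subr_ge0 /U (_ : _ - _ = (A * a + (M - u x1) + (M - A * b)) * (gamma * w y)); last by ring.
    rewrite mulr_ge0 ?mulr_ge0//; last exact: ltW.
    by apply: addr_ge0; [apply: addr_ge0|]; rewrite ?subr_ge0.
  rewrite lerD2r ler_wpM2l ?subr_ge0//; apply: le_trans K1; rewrite ler_wpM2l//; exact: ltW.
have UFar y : Far y -> U y <= h y + Gamma * M * w y.
  move=> Fy; have yr := far_enorm _ _ _ Fy; have y0 := lt_le_trans rho10 yr.
  have /andP[K1 K2] := kernel_bounds _ _ _ _ _ hK y y0.
  have wE : kern (enorm (y - x1)) = w y by rewrite /w /tail_weight (max_idPr yr).
  rewrite wE in K1 K2.
  have e1 : U y <= u y * K (x1 - y).
    by rewrite /U mulrA mulrC ler_wpM2l.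
  have e2 : u x1 * K (x1 - y) <= Gamma * M * w y.
    apply: (@le_trans _ _ (u x1 * (Gamma * w y))); first by rewrite ler_wpM2l.
    rewrite mulrA [Gamma * M]mulrC -!mulrA ler_wpM2r// mulr_ge0//; exact: ltW.
  rewrite /h mulrBl; move: e1 e2; lra.
have bAnn : (\int[leb]_(y in Ann) (U y)%:E <= (intR Ann h - intR Ann k + 2 * gamma * M * intR Ann w)%:E)%E.
  have wi2 := integZ _ _ (2 * gamma * M) mAnn wAnn.
  have hki := integB _ _ _ mAnn hAnn ki.
  have ii := integD _ _ _ mAnn hki wi2.
  have Ui : integ Ann U.
    apply: (integ_le _ _ _ mAnn _ ii); first exact: measurable_funTS.
    by move=> y /UAnn; rewrite ger0_norm.
  rewrite intRE// lee_fin; apply: le_trans (le_intR _ _ _ mAnn Ui ii UAnn) _.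
  by rewrite intRD// intRB// intRZ.
have bFar : (\int[leb]_(y in Far) (U y)%:E <= (intR Far h + Gamma * M * intR Far w)%:E)%E.
  have wi2 := integZ _ _ (Gamma * M) mFar wFar.
  have ii := integD _ _ _ mFar hFar wi2.
  have Ui : integ Far U.
    apply: (integ_le _ _ _ mFar _ ii); first exact: measurable_funTS.
    by move=> y /UFar; rewrite ger0_norm.
  rewrite intRE// lee_fin; apply: le_trans (le_intR _ _ _ mFar Ui ii UFar) _.
  by rewrite intRD// intRZ.
rewrite -/P -/U PE ge0_integral_setU.
- apply: le_trans (leeD bAnn bFar) _; rewrite -EFinD lee_fin.
  have w1 : intR Ann w <= tail_cst rho1.
    by apply: le_trans wb; apply: intR_subset => //; exact: measurableT.
  have w2 : intR Far w <= tail_cst rho1.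
    by apply: le_trans wb; apply: intR_subset => //; exact: measurableT.
  have g1 : 2 * gamma * M * intR Ann w <= 2 * gamma * M * tail_cst rho1.
    by rewrite ler_wpM2l// !mulr_ge0// ltW.
  have g2 : Gamma * M * intR Far w <= Gamma * M * tail_cst rho1.
    by rewrite ler_wpM2l// !mulr_ge0// ltW.
  have -> : (2 * gamma + Gamma) * M * tail_cst rho1 =
    2 * gamma * M * tail_cst rho1 + Gamma * M * tail_cst rho1 by ring.
  move: hb kb g1 g2; rewrite hE; lra.
- exact: mAnn.
- exact: mFar.
- by apply: measurable_funTS; exact/measurable_EFinP.
- by move=> y _; rewrite lee_fin; exact: U0.
- by apply/disj_setPS; rewrite AF.
Qed.

(** The gain in the estimate from above: subtracting the constant [u x0] costs
    the mass of the kernel outside the ball, which is of order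
    [rho `^ (- (2 * s))]. *)
Lemma far_le_of_tail (u : V -> R) (x0 : V) (rho S : R) : (0 < N)%N ->
  continuous u -> (forall y, 0 <= u y) -> 0 < rho ->
  (\int[leb]_(y in (~` eball x0 rho : set W)) (u y * kern (enorm (y - x0)))%:E <= S%:E)%E ->
  (\int[leb]_(y in (~` eball x0 rho : set W)) ((u y - u x0) * K (x0 - y))%:E <=
   (Gamma * S - gamma * (u x0 * (low_cst * rho `^ (- (2 * s)))))%:E)%E.
Proof.
move=> N0 cu u0 rho0 hS.
have G0 := lt_le_trans gamma0 gG.
pose P : set W := ~` eball x0 rho.
have mP : measurable P := measurable_far x0 rho.
have mu : measurable_fun setT (u : W -> R) by exact: continuous_measurable_rV.
have [ui ub] : integ P (fun y : W => u y * kern (enorm (y - x0))) /\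
    intR P (fun y : W => u y * kern (enorm (y - x0))) <= S.
  apply: integ_ge0_bound; [exact: mP| | |exact: hS].
    by apply: measurable_funTS; apply: measurable_funM; [exact: mu|exact: measurable_kern].
  by move=> y _; rewrite mulr_ge0 ?kern_ge0.
have [ki _] := far_kern_integ _ x0 s01 rho rho0.
have kl := far_kern_ge _ x0 s01 rho N0 rho0.
have Gi := integZ _ _ Gamma mP ui.
have gi := integZ _ _ (gamma * u x0) mP ki.
have ri := integB _ _ _ mP Gi gi.
have Ki := far_kernel_integ _ _ _ _ x0 gamma0 s01 hK rho rho0.
have b y : P y -> (u y - u x0) * K (x0 - y) <=
    Gamma * (u y * kern (enorm (y - x0))) - gamma * u x0 * kern (enorm (y - x0)).
  move=> /far_enorm yr; have y0 := lt_le_trans rho0 yr.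
  have /andP[K1 K2] := kernel_bounds _ _ _ _ _ hK y y0.
  rewrite mulrBl; apply: lerB; first by rewrite mulrCA ler_wpM2l.
  by rewrite [gamma * _]mulrC -mulrA ler_wpM2l.
have hi : integ P (fun y : W => (u y - u x0) * K (x0 - y)).
  have ui2 : integ P (fun y : W => u y * K (x0 - y)).
    apply: (integ_le _ _ _ mP _ Gi).
      apply: measurable_funTS; apply: measurable_funM; first exact: mu.
      exact: (measurable_kernel_at _ _ _ _ _ hK).
    move=> y /far_enorm yr; have y0 := lt_le_trans rho0 yr.
    have /andP[_ K2] := kernel_bounds _ _ _ _ _ hK y y0.
    rewrite ger0_norm ?mulr_ge0 ?(kernel_ge0 _ _ _ _ _ gamma0 hK)//.
    by rewrite mulrCA ler_wpM2l.
  have := integB _ _ _ mP ui2 (integZ _ _ (u x0) mP Ki).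
  by apply: eq_integrable => // y _ /=; rewrite mulrBl.
rewrite intRE// lee_fin; apply: le_trans (le_intR _ _ _ mP hi ri b) _.
rewrite intRB// !intRZ//; apply: lerB; first by rewrite ler_wpM2l// ltW.
by rewrite -mulrA ler_wpM2l ?(ltW gamma0)// ler_wpM2l.
Qed.

(** Recentring the tail from [x1] to [x0]: by the triangle inequality
    [|y - x1| <= ((1 + D) / rho) * |y - x0|] outside the ball of radius [rho],
    and the profile is multiplicative. *)
Lemma kern_le_tail_weight (x0 x1 y : V) (rho rho1 D : R) :
  0 < rho <= 1 -> 0 < rho1 <= 1 -> 0 <= D -> enorm (x0 - x1) <= D -> rho <= enorm (y - x0) ->
  kern (enorm (y - x0)) <= kern (1 + D)^-1 * kern rho * tail_weight rho1 x1 y.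
Proof.
move=> /andP[rho0 rho1'] /andP[r10 r1] D0 xD yr.
have y0 := lt_le_trans rho0 yr.
have D1 : 0 < 1 + D by lra.
have e0 : 0 < (1 + D)^-1 by rewrite invr_gt0.
have t0 : 0 < (1 + D)^-1 * rho by rewrite mulr_gt0.
have le1 : (1 + D)^-1 * rho <= 1.
  by rewrite mulrC ler_pdivrMr// mul1r; lra.
have m0 : 0 < Num.max rho1 (enorm (y - x1)).
  by rewrite lt_max r10.
rewrite -kernM ?(ltW rho0) ?(ltW e0)// -kernM ?(ltW t0) ?(ltW m0)//.
apply: (kern_anti _ s01); first by rewrite mulr_gt0.
rewrite -mulrA mulrC ler_pdivrMr// mulrDr mulr1 maxr_pMr ?(ltW rho0)// ge_max.
have yD : 0 <= enorm (y - x0) * D by rewrite mulr_ge0 ?enorm_ge0.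
apply/andP; split.
  have : rho * rho1 <= rho * 1 by rewrite ler_wpM2l// ltW.
  lra.
have tri : enorm (y - x1) <= enorm (y - x0) + D.
  by apply: le_trans (enorm_triangle x0 _ _) _; rewrite lerD2l.
apply: (@le_trans _ _ (rho * (enorm (y - x0) + D))); first by rewrite ler_wpM2l// ltW.
rewrite mulrDr; apply: lerD.
  by rewrite ler_piMl// enorm_ge0.
by rewrite ler_wpM2r.
Qed.

End ContactEstimates.

(** * Contact points and inf-sup operators *)

Section Contact.
Context {R : realType} {N : nat}.
Local Notation V := 'rV[R]_N.
Implicit Types (u v : V -> R) (x y z : V).

Lemma semicontinuous_continuous u : usc u -> lsc u -> continuous u.
Proof.
move=> uu lu x.
suff : forall e : R, 0 < e -> \forall y \near x, `|u x - u y| < e.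
  by move=> H; apply/(@cvgrPdist_lt R R^o V (nbhs x) (nbhs_filter x) u (u x)); exact: H.
move=> e e0.
have [V1 nV1 hV1] := lu x (u x - e) ltac:(rewrite lte_fin; lra).
have [V2 nV2 hV2] := uu x (- u x - e) ltac:(rewrite lte_fin; lra).
near=> y.
have h1 : ((u x - e)%:E < (u y)%:E)%E by apply: hV1; near: y; exact: nV1.
have h2 : ((- u x - e)%:E < (- u y)%:E)%E by apply: hV2; near: y; exact: nV2.
by move: h1 h2; rewrite !lte_fin => h1 h2; rewrite ltr_norml; apply/andP; split; lra.
Unshelve. all: by end_near. Qed.

(** Outside the ball of half the radius, a paraboloid of opening
    [4 * H / r ^+ 2] is higher than [H], the amount by which [v] can exceed
    [v z]; so the maximum of the difference lies well inside. *)
Lemma paraboloid_contact v z (r H : R) : continuous v -> 0 < r -> 0 < H ->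
  (forall y, cball z r y -> v y <= v z + H) ->
  let A := 4 * H / r ^+ 2 in
  exists x0, [/\ enorm (x0 - z) <= r / 2, v z + A * enorm (x0 - z) ^+ 2 <= v x0 &
    forall y, cball z r y ->
      v y - A * enorm (y - z) ^+ 2 <= v x0 - A * enorm (x0 - z) ^+ 2].
Proof.
move=> cv r0 H0 vH A.
have zB : cball z r z by rewrite /cball/= subrr enorm0 ltW.
have cF : continuous (fun y => v y - A * enorm (y - z) ^+ 2).
  move=> y; apply: (@continuousB _ _ _ v (fun y => A * enorm (y - z) ^+ 2)).
    exact: cv.
  apply: (@continuousM _ _ (cst A) (fun y => enorm (y - z) ^+ 2)).
    exact: cst_continuous.
  exact: continuous_enorm_sqr.
have [|x0 x0B x0max] := EVT_max_rV (ex_intro _ z zB) (compact_cball z r)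
  (f := fun y => v y - A * enorm (y - z) ^+ 2).
  by apply: continuous_subspaceT.
have {}x0max y : cball z r y -> v y - A * enorm (y - z) ^+ 2 <= v x0 - A * enorm (x0 - z) ^+ 2.
  by move=> yB; apply: x0max; rewrite inE.
move: x0B; rewrite inE => x0B.
have h0 : v z + A * enorm (x0 - z) ^+ 2 <= v x0.
  by have := x0max z zB; rewrite subrr enorm0 expr0n/= mulr0 subr0; lra.
exists x0; split => //.
have h1 : A * enorm (x0 - z) ^+ 2 <= H by have := vH x0 x0B; lra.
have r20 : 0 < r ^+ 2 by rewrite exprn_gt0.
rewrite -(@ler_pXn2r _ 2)// ?nnegrE ?enorm_ge0 ?divr_ge0 ?(ltW r0)//.
have h2 : 4 * H * enorm (x0 - z) ^+ 2 <= H * r ^+ 2.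
  by rewrite -ler_pdivrMr// mulrAC.
move: h2; rewrite [4 * H]mulrC -mulrA ler_pM2l// => h2.
rewrite expr_div_n ler_pdivlMr ?exprn_gt0//; apply: le_trans h2.
by rewrite mulrC -natrX.
Qed.

End Contact.

Section InfSup.
Context {R : realType} {I J : Type}.
Implicit Types F : I -> J -> \bar R.

Lemma infsup_le_exists F (t f d : R) : 0 < d -> (infsup F + t%:E <= f%:E)%E ->
  exists i, forall j, (F i j <= (f - t + d)%:E)%E.
Proof.
move=> d0 h.
have : (infsup F < (f - t + d)%:E)%E.
  move: h; rewrite -leeBrDr// -EFinB => /le_lt_trans; apply.
  by rewrite lte_fin ltrDl.
move=> /ereal_inf_lt[_ [i _ <-]] /ltW h2; exists i => j.
by apply: le_trans h2; apply: ereal_sup_ubound; exists j.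
Qed.

Lemma le_infsup_bound F (t f b : R) (i : I) : (f%:E <= infsup F + t%:E)%E ->
  (forall j, (F i j <= b%:E)%E) -> f <= b + t.
Proof.
move=> h Fb; rewrite -lee_fin EFinD; apply: le_trans h _; apply: leeD => //.
apply: (@le_trans _ _ (ereal_sup (range (F i)))).
  by apply: ereal_inf_lbound; exists i.
by apply: ge_ereal_sup => _ [j _ <-].
Qed.

Lemma le_infsup_inhabited F (t f : R) (i : I) : (f%:E <= infsup F + t%:E)%E -> inhabited J.
Proof.
move=> h; have [//|noJ] := pselect (inhabited J).
have := le_infsup_bound F t f (f - t - 1) i h.
suff : forall j, (F i j <= (f - t - 1)%:E)%E by move=> /[swap] /[apply]; lra.
by move=> j; exfalso; apply: noJ.
Qed.

End InfSup.

(** * Tail estimate and local boundedness *)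

Section HarnackSteps.
Context {R : realType} {N : nat}.
Local Notation V := 'rV[R]_N.
Local Notation W := (lebesgue_rV R N).
Variables (gamma Gamma s : R) (I J : Type) (K : I -> J -> V -> R).
Variables (Omega : set V) (c f u : V -> R) (g : V -> V -> R) (M1 c0 : R).
Hypotheses (N0 : (0 < N)%N) (gamma0 : 0 < gamma) (gG : gamma <= Gamma).
Hypothesis hs : 1 / 2 < s < 1.
Hypothesis hK : forall i j, kernel_class gamma Gamma s (K i j).
Hypotheses (M10 : 0 <= M1) (c00 : 0 <= c0).
Hypothesis hc : forall x, Omega x -> `|c x| <= c0.
Hypothesis hg : forall x p, Omega x -> `|g x p| <= M1 * enorm p.
Hypotheses (cu : continuous u) (u0 : forall x, 0 <= u x).
Local Notation kern := (@kern R N s).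
Local Notation near_cst := (@near_cst R N s).
Local Notation far_cst := (@far_cst R N s).
Local Notation low_cst := (@low_cst R N s).
Local Notation tail_weight := (@tail_weight R N s).
Local Notation tail_cst := (@tail_cst R N s).

Lemma s01 : 0 < s < 1.
Proof. by case/andP: hs => h1 h2; apply/andP; split; lra. Qed.

Lemma lower_order_le (b : R) (z x0 : V) (rho M : R) : 0 < rho ->
  Omega x0 -> u x0 <= M ->
  `|g x0 (grad (paraboloid b z x0 rho) x0) + c x0 * u x0| <=
    M1 * (2 * `|b| * enorm (x0 - z)) + c0 * M.
Proof.
move=> rho0 Ox uM; apply: le_trans (ler_normD _ _) _; apply: lerD.
  apply: le_trans (hg _ _ Ox) _; rewrite grad_paraboloid//; exact: eball_center.
by rewrite normrM (ger0_norm (u0 x0)) ler_pM// hc.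
Qed.

Lemma test_paraboloid (b : R) (z x0 : V) (rho : R) : 0 < rho ->
  eball x0 rho `<=` Omega -> test_function Omega rho (paraboloid b z x0 rho) x0.
Proof.
by move=> rho0 sub; split => //; [exact: C2_paraboloid|apply: Linfty_paraboloid; exact: ltW].
Qed.

Definition tail_total (r : R) : R := 2 + 4 * M1 / r + c0 +
  8 / r ^+ 2 * (Gamma * (near_cst * (r / 2) `^ (2 - 2 * s))) +
  (2 * gamma + Gamma) * tail_cst (r / 2) + gamma.

Lemma tail_total_ge0 (r : R) : 0 < r -> 0 <= tail_total r.
Proof.
move=> r0; have G0 := lt_le_trans gamma0 gG.
have n0 := near_cst_ge0 (N := N) _ s01; have f0 := far_cst_ge0 (N := N) _ s01.
have h1 : 0 <= 4 * M1 / r by rewrite divr_ge0 ?mulr_ge0// ltW.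
have h2 : 0 <= 8 / r ^+ 2 * (Gamma * (near_cst * (r / 2) `^ (2 - 2 * s))).
  apply: mulr_ge0; first by rewrite divr_ge0// sqr_ge0.
  by apply: mulr_ge0; [exact: ltW|apply: mulr_ge0; [exact: n0|exact: powR_ge0]].
have h3 : 0 <= (2 * gamma + Gamma) * tail_cst (r / 2).
  apply: mulr_ge0; first by rewrite addr_ge0 ?mulr_ge0// ltW.
  apply: addr_ge0; last by apply: mulr_ge0; [exact: f0|exact: powR_ge0].
  by rewrite mulr_ge0 ?kern_ge0 ?exprn_ge0 ?mulr_ge0 ?divr_ge0// ltW.
apply: addr_ge0; last exact: ltW.
apply: addr_ge0; last exact: h3.
apply: addr_ge0; last exact: h2.
by apply: addr_ge0; [apply: addr_ge0|].
Qed.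

(** For empty [J] every supremum is [-oo], which contradicts the inequality at
    any contact point from above. *)
Lemma subsolution_inhabited (z : V) (r : R) : 0 < r -> eball z r `<=` Omega ->
  viscosity_subsolution K g c f Omega u -> I -> inhabited J.
Proof.
move=> r0 zO [_ hsub] i.
have zB : cball z r z by rewrite /cball/= subrr enorm0 ltW.
have [|y yB ymax] := EVT_max_rV (ex_intro _ z zB) (compact_cball z r) (f := u).
  exact: continuous_subspaceT.
have {}ymax x : cball z r x -> u x <= u y by move=> xB; apply: ymax; rewrite inE.
have H0 : 0 < u y - u z + 1 by have := ymax z zB; lra.
have [x xB|x0 [x0z _ hmax]] := paraboloid_contact u z r _ cu r0 H0.
  by have := ymax x xB; lra.
have r20 : 0 < r / 2 by rewrite divr_gt0.
have bz x : eball x0 (r / 2) x -> eball z r x by apply: eball_sub; lra.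
set A := _ / _ in hmax.
have := hsub x0 (zO _ (bz _ (eball_center _ _ r20))) _ _
  (test_paraboloid A z x0 _ r20 (fun y yb => zO y (bz y yb))).
move=> H; apply: (le_infsup_inhabited _ _ _ i (H _)) => x xb.
rewrite (paraboloidE _ _ _ _ _ xb) (paraboloidE _ _ _ _ _ (eball_center _ _ r20)).
by apply: hmax; apply: ltW; exact: bz.
Qed.

(** The tail estimate, by contact from below: [tail_le_of_contact] covers the
    complement of a ball around the contact point, and continuity of [u] makes
    the rest negligible when that ball is small. *)
Lemma supersolution_tail (z : V) (r M : R) : 0 < r <= 1 -> eball z r `<=` Omega ->
  0 < M -> u z <= M -> (forall x, Omega x -> `|f x| <= M) -> (I -> inhabited J) ->
  viscosity_supersolution K g c f Omega u ->
  exists x1, [/\ eball z r x1, inhabited I &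
    (\int[leb]_(y in setT) (gamma * (tail_weight (r / 2) x1 y * u y))%:E
      <= (tail_total r * M)%:E)%E].
Proof.
move=> /andP[r0 r1] zO M0 uzM fM hJ [_ hsup].
have r20 : 0 < r / 2 by rewrite divr_gt0.
have cNu : continuous (fun y => - u y) by move=> y; apply: continuousN; exact: cu.
have [y _|x1 [x1z hval hmin]] := paraboloid_contact (fun y => - u y) z r M cNu r0 M0.
  by have := u0 y; have := u0 z; lra.
set A := 4 * M / r ^+ 2 in hval hmin.
have r2 : 0 < r ^+ 2 by rewrite exprn_gt0.
have A0 : 0 <= A by rewrite divr_ge0 ?mulr_ge0 ?(ltW M0)// ltW.
have AE0 : 0 <= A * enorm (x1 - z) ^+ 2 by rewrite mulr_ge0 ?sqr_ge0.
have ux1 : u x1 <= M by lra.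
have AM : A * enorm (x1 - z) ^+ 2 <= M by have := u0 x1; lra.
have x1b : eball z r x1 by rewrite /eball/=; lra.
have ballz y : eball x1 (r / 2) y -> eball z r y by apply: eball_sub; lra.
have touch y : eball x1 (r / 2) y ->
    u x1 + A * enorm (x1 - z) ^+ 2 <= u y + A * enorm (y - z) ^+ 2.
  by move=> /ballz yz; have := hmin y (ltW yz); lra.
(* The bound on [u] here holds on a ball whose radius is not controlled by the
   data; it only enters the choice of [rho]. *)
have [del del0 hdel] : exists2 del : R, 0 < del & forall y, eball x1 del y -> u y <= M + 1.
  have : \forall y \near x1, u y < u x1 + 1.
    have := (@cvgrPdist_lt R R^o V (nbhs x1) (nbhs_filter x1) u (u x1)).1 (cu x1) 1 ltr01.
    by apply: filterS => y; rewrite ltr_norml => /andP[]; lra.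
  move=> /nbhs_ballP[del /= del0 hdel]; exists del => // y yd.
  suff : u y < u x1 + 1 by lra.
  apply: hdel; apply: ball_rV_coord => // i.
  have := coord_le_enorm (y - x1) i; rewrite !mxE distrC => /le_lt_trans; exact.
pose k := kern (r / 2); have k0 : 0 < k by apply: kern_gt0.
pose rho := Num.min (Num.min del (r / 4)) (M / (2 * ((M + 1) * k))).
have Mk : 0 < 2 * ((M + 1) * k) by rewrite !mulr_gt0//; lra.
have rho0 : 0 < rho by rewrite !lt_min del0 !divr_gt0.
have rho_del : rho <= del by rewrite /rho !ge_min lexx.
have rho_r : rho <= r / 4 by rewrite /rho !ge_min lexx !orbT.
have rho_M : 2 * rho * ((M + 1) * k) <= M.
  have : rho <= M / (2 * ((M + 1) * k)) by rewrite /rho !ge_min lexx !orbT.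
  by rewrite ler_pdivlMr// [rho * _]mulrCA mulrA.
have rhor2 : rho < r / 2 by lra.
have subO : eball x1 rho `<=` Omega.
  by move=> y yb; apply/zO/ballz; apply: lt_trans yb _.
have Ox1 : Omega x1 by apply: subO; exact: eball_center.
pose phi := paraboloid (- A) z x1 rho.
have phiE y : eball x1 rho y -> phi y = - A * enorm (y - z) ^+ 2.
  exact: paraboloidE.
have htest := hsup x1 Ox1 rho phi (test_paraboloid (- A) z x1 rho rho0 subO).
have {htest} : (test_value K g c u rho phi x1 <= (f x1)%:E)%E.
  apply: htest => y yb; rewrite (phiE y yb) (phiE x1 (eball_center _ _ rho0)).
  have := touch y (lt_trans yb rhor2); lra.
move=> /(infsup_le_exists _ _ _ M M0)[i hi]; have [j0] := hJ i.
have lo : M1 * (2 * `|- A| * enorm (x1 - z)) + c0 * M <= (4 * M1 / r + c0) * M.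
  rewrite normrN (ger0_norm A0) [leRHS]mulrDl lerD2r.
  have -> : 4 * M1 / r * M = M1 * (2 * A * (r / 2)).
    by rewrite /A; field; rewrite gt_eqF.
  by rewrite ler_wpM2l// ler_wpM2l// mulr_ge0.
have low := lower_order_le (- A) z x1 rho M rho0 Ox1 ux1.
have fx := fM x1 Ox1.
set t := g x1 _ + _ in hi low.
have ft : f x1 - t + M <= (2 + 4 * M1 / r + c0) * M.
  have h1 := le_trans (ler_norm _) fx.
  have h2 : - t <= (4 * M1 / r + c0) * M.
    by apply: le_trans lo; apply: le_trans low; rewrite -normrN ler_norm.
  have -> : (2 + 4 * M1 / r + c0) * M = M + (4 * M1 / r + c0) * M + M by ring.
  lra.
pose E1 := Gamma * (near_cst * (r / 2) `^ (2 - 2 * s)).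
have G0 := lt_le_trans gamma0 gG.
have [m [/andP[m0 mE] LKm]] := LK_paraboloid _ _ _ _ x1 gamma0 gG s01 (hK i j0) (- A) z rho rho0.
have mE1 : m <= E1.
  apply: le_trans mE _; rewrite ler_wpM2l ?(ltW G0)// ler_wpM2l ?near_cst_ge0 ?s01//.
  apply: ge0_ler_powR; rewrite ?nnegrE ?(ltW rho0) ?(ltW r20) ?(ltW rhor2)//.
  by case/andP: hs => _ h; lra.
have hfar : (\int[leb]_(y in (~` eball x1 rho : set W)) ((u y - u x1) * K i j0 (x1 - y))%:E
    <= ((2 + 4 * M1 / r + c0) * M + A * E1)%:E)%E.
  have := hi j0; rewrite LKm LK_far//.
  rewrite addeC -leeBrDr// -EFinB => /le_trans; apply; rewrite lee_fin.
  have : A * m <= A * E1 by rewrite ler_wpM2l.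
  lra.
have tail := tail_le_of_contact _ _ _ _ gamma0 gG s01 (hK i j0) u x1 z _ _ _ _ _
  cu u0 rho0 rhor2 A0 ux1 AM touch hfar.
exists x1; split; [exact: x1b|exact: (inhabits i)|].
pose U (y : W) := gamma * (tail_weight (r / 2) x1 y * u y).
have mU : measurable_fun setT U.
  apply: measurable_funM; first exact: measurable_cst.
  apply: measurable_funM; first exact: measurable_tail_weight.
  exact: continuous_measurable_rV.
have U0 y : 0 <= U y by rewrite !mulr_ge0 ?tail_weight_ge0// ltW.
rewrite (integral_split_eball x1 rho U mU U0).
have near : (\int[leb]_(y in (eball x1 rho : set W)) (U y)%:E <= (gamma * M)%:E)%E.
  have kM : 0 <= gamma * (k * (M + 1)) by rewrite !mulr_ge0 ?(ltW gamma0) ?(ltW k0)//; lra.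
  apply: le_trans (integral_eball_le x1 rho U _ (ltW rho0) kM mU U0 _) _.
    move=> y yb; rewrite ler_wpM2l ?(ltW gamma0)//; apply: ler_pM => //.
    - exact: tail_weight_ge0.
    - by apply: (kern_anti _ s01) => //; rewrite le_max lexx.
    - by apply: hdel; exact: lt_le_trans yb rho_del.
  rewrite lee_fin -mulrA ler_wpM2l ?(ltW gamma0)//.
  apply: (@le_trans _ _ (k * (M + 1) * (2 * rho))).
    rewrite ler_wpM2l//; first by rewrite mulr_ge0 ?(ltW k0)//; lra.
    have : (0 < N)%N by []. case: (N) => // n _; rewrite exprS ler_piMr//; first by lra.
    by rewrite exprn_ile1//; lra.
  by rewrite mulrC [k * _]mulrC.
apply: le_trans (leeD near tail) _; rewrite -EFinD lee_fin /tail_total -/E1.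
rewrite le_eqVlt; apply/orP; left; apply/eqP; rewrite /A; field.
by rewrite gt_eqF.
Qed.

Lemma integral_recentre_tail (x0 x1 : V) (rho r1 D T : R) :
  0 < rho <= 1 -> 0 < r1 <= 1 -> 0 <= D -> enorm (x0 - x1) <= D ->
  (\int[leb]_(y in setT) (gamma * (tail_weight r1 x1 y * u y))%:E <= T%:E)%E ->
  (\int[leb]_(y in (~` eball x0 rho : set W)) (u y * kern (enorm (y - x0)))%:E
    <= (kern rho * (kern (1 + D)^-1 * (T / gamma)))%:E)%E.
Proof.
move=> rho01 r101 D0 xD hT.
pose P : set W := ~` eball x0 rho.
have mP : measurable P := measurable_far x0 rho.
have mu : measurable_fun setT (u : W -> R) by exact: continuous_measurable_rV.
pose U (y : W) := gamma * (tail_weight r1 x1 y * u y).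
have mU : measurable_fun setT U.
  apply: measurable_funM; first exact: measurable_cst.
  by apply: measurable_funM; [exact: measurable_tail_weight|exact: mu].
have U0 y : 0 <= U y by rewrite !mulr_ge0 ?tail_weight_ge0// ltW.
have mUE : measurable_fun setT (EFin \o U) by exact/measurable_EFinP.
pose k := kern rho * kern (1 + D)^-1 / gamma.
have k0 : 0 <= k by rewrite divr_ge0 ?mulr_ge0 ?kern_ge0// ltW.
apply: (@le_trans _ _ (\int[leb]_(y in P) (k%:E * (U y)%:E))%E).
  apply: ge0_le_integral; first exact: mP.
  - by move=> y _; rewrite lee_fin mulr_ge0 ?kern_ge0.
  - apply: measurable_funTS; apply/measurable_EFinP.
    by apply: measurable_funM; [exact: mu|exact: measurable_kern].
  - by apply: measurable_funTS; apply: measurable_funeM; exact: mUE.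
  - move=> y /far_enorm yr; rewrite -EFinM lee_fin.
    have := kern_le_tail_weight _ s01 x0 x1 y rho r1 D rho01 r101 D0 xD yr.
    move=> /(ler_wpM2l (u0 y)) /le_trans; apply.
    rewrite le_eqVlt; apply/orP; left; apply/eqP; rewrite /k /U; field.
    by rewrite gt_eqF.
have UP0 y : P y -> (0 <= (U y)%:E)%E by rewrite lee_fin.
have mUP : measurable_fun P (fun y => (U y)%:E) by exact: measurable_funTS.
have -> : (\int[leb]_(y in P) (k%:E * (U y)%:E) = k%:E * \int[leb]_(y in P) (U y)%:E)%E.
  exact: (ge0_integralZl_EFin leb mP UP0 mUP k0).
have -> : (kern rho * (kern (1 + D)^-1 * (T / gamma)))%:E = (k%:E * T%:E)%E.
  by rewrite -EFinM /k; congr _%:E; ring.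
apply: lee_wpmul2l; first by rewrite lee_fin.
apply: le_trans hT; apply: ge0_subset_integral; first exact: mP.
- exact: measurableT.
- exact: mUE.
- by move=> y _; rewrite lee_fin; exact: U0.
- exact: subsetT.
Qed.

Lemma bernoulli (t : R) (n : nat) : 0 <= t <= 1 -> 1 - n%:R * t <= (1 - t) ^+ n.
Proof.
move=> /andP[t0 t1]; elim: n => [|n IHn]; first by rewrite mul0r subr0 expr0.
rewrite exprS; apply: (@le_trans _ _ ((1 - t) * (1 - n%:R * t))).
  rewrite -natr1 -subr_ge0 (_ : _ - _ = n%:R * t ^+ 2); last by ring.
  by rewrite mulr_ge0 ?sqr_ge0.
by rewrite ler_wpM2l// subr_ge0.
Qed.

(** The point [xh] maximises [u] weighted by the power [N] of the distance to
    the boundary, and [d] is that distance at [xh].  On a ball of radius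
    [th * d] the weight drops by the factor [(1 - th) ^+ N] at most, and
    [1 <= (1 + eta) * (1 - th) ^+ N] by Bernoulli's inequality when
    [th = eta / (2 * N)]. *)
Lemma weighted_max (z : V) (r eta : R) : 0 < r -> 0 < eta <= 1 -> 0 < u z ->
  exists xh d, [/\ 0 < d <= r, 0 < u xh, enorm (xh - z) + d <= r,
    u z * r ^+ N <= u xh * d ^+ N &
    forall y, enorm (y - xh) <= eta / (2 * N%:R) * d -> u y <= (1 + eta) * u xh].
Proof.
move=> r0 /andP[e0 e1] uz.
have NR : 0 < N%:R :> R by rewrite ltr0n.
have N1 : 1 <= N%:R :> R by rewrite ler1n.
have zB : cball z r z by rewrite /cball/= subrr enorm0 ltW.
pose Wt y := u y * (r - enorm (y - z)) ^+ N.
have cWt : continuous Wt.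
  move=> y; apply: (@continuousM _ _ u (fun y => (r - enorm (y - z)) ^+ N)); first exact: cu.
  apply: (@continuous_comp _ _ _ (fun y : V => r - enorm (y - z)) (@GRing.exp R ^~ N)).
    apply: (@continuousB R R V (fun=> r) (fun y : V => enorm (y - z))); first exact: cst_continuous.
    exact: continuous_enorm.
  exact: exprn_continuous.
have [|xh xhB hmax] := EVT_max_rV (ex_intro _ z zB) (compact_cball z r) (f := Wt).
  exact: continuous_subspaceT.
move: xhB; rewrite inE /cball/= => xhB.
have {}hmax y : cball z r y -> Wt y <= Wt xh by move=> yB; apply: hmax; rewrite inE.
pose d := r - enorm (xh - z).
have Wz : u z * r ^+ N <= u xh * d ^+ N by have := hmax z zB; rewrite /Wt subrr enorm0 subr0.
have Wp : 0 < u xh * d ^+ N by apply: lt_le_trans Wz; rewrite mulr_gt0 ?exprn_gt0.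
have dge : 0 <= d by rewrite subr_ge0.
have d0 : 0 < d.
  rewrite lt_neqAle dge andbT; apply/eqP => d0; move: Wp.
  by rewrite -d0 expr0n (gtn_eqF N0) mulr0 ltxx.
have uxh : 0 < u xh by rewrite -(pmulr_lgt0 _ (exprn_gt0 N d0)).
exists xh, d; split => //.
- by rewrite d0 /d lerBlDr lerDl enorm_ge0.
- by rewrite /d addrC subrK.
move=> y; set th := eta / (2 * N%:R) => yx.
have th0 : 0 < th by rewrite divr_gt0// mulr_gt0.
have th1 : th <= 1 by rewrite ler_pdivrMr ?mulr_gt0//; lra.
have Nth : N%:R * th = eta / 2 by rewrite /th; field; rewrite gt_eqF.
have thd : th * d <= d by rewrite ler_piMl// ltW.
have yz : enorm (y - z) <= th * d + enorm (xh - z).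
  by apply: le_trans (enorm_triangle xh _ _) _; rewrite lerD2r.
have yB : cball z r y by rewrite /cball/=; move: yz thd; rewrite /d; lra.
have dd : (1 - th) * d <= r - enorm (y - z) by move: yz; rewrite /d; lra.
have dd0 : 0 <= (1 - th) * d by rewrite mulr_ge0// subr_ge0.
have h1 : u y * (1 - th) ^+ N <= u xh.
  rewrite -(ler_pM2r (exprn_gt0 N d0)) -mulrA -exprMn.
  apply: le_trans (hmax y yB); rewrite /Wt ler_wpM2l//.
  by rewrite ler_pXn2r// ?nnegrE//; exact: le_trans dd0 dd.
have ber : 1 - eta / 2 <= (1 - th) ^+ N.
  by rewrite -Nth; apply: bernoulli; rewrite th1 ltW.
have h2 : u y * (1 - eta / 2) <= u xh by apply: le_trans h1; rewrite ler_wpM2l.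
apply: (@le_trans _ _ (u y * (1 - eta / 2) * (1 + eta))); last first.
  by rewrite mulrC ler_wpM2l//; lra.
rewrite -mulrA ler_peMr//.
have : 0 <= eta * (1 - eta) by rewrite mulr_ge0//; lra.
lra.
Qed.

(** Local boundedness, by contact from above near the weighted maximum [xh].  With
    [U = u xh] and [P = rho `^ (- (2 * s))], the far part contributes
    [- gamma * low_cst * U * P]; all other terms except the tail are at most
    [eta * (Gamma * near_cst + 2 * M1 + 2 * c0) * U * P], and [eta] is small
    enough for half of the gain to survive. *)
Lemma subsolution_bound (z x1 : V) (r r1 M T D eta : R) (i : I) :
  0 < r <= 1 -> eball z r `<=` Omega -> 0 <= M ->
  (forall x, Omega x -> `|f x| <= M) ->
  viscosity_subsolution K g c f Omega u ->
  0 < r1 <= 1 -> 0 <= D -> (forall x, eball z r x -> enorm (x - x1) <= D) -> 0 <= T ->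
  (\int[leb]_(y in setT) (gamma * (tail_weight r1 x1 y * u y))%:E <= T%:E)%E ->
  0 < eta <= 1 -> eta * (Gamma * near_cst + 2 * M1 + 2 * c0) <= gamma * low_cst / 2 ->
  u z * r ^+ N <= (4 * N%:R / eta) ^+ N *
    (2 / (gamma * low_cst) * (M + Gamma * (kern (1 + D)^-1 * (T / gamma)))).
Proof.
move=> /andP[r0 rle1] zO M0 fM [_ hsub] r101 D0 xD T0 hT eta01 heta.
have G0 := lt_le_trans gamma0 gG.
have NR : 0 < N%:R :> R by rewrite ltr0n.
have /andP[e0 e1] := eta01.
have low0 : 0 < low_cst by apply: kern_gt0; rewrite mulr_gt0.
pose S0 := kern (1 + D)^-1 * (T / gamma).
have S00 : 0 <= S0 by rewrite mulr_ge0 ?kern_ge0// divr_ge0// ltW.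
have rhs0 : 0 <= (4 * N%:R / eta) ^+ N * (2 / (gamma * low_cst) * (M + Gamma * S0)).
  rewrite mulr_ge0 ?exprn_ge0// ?divr_ge0 ?mulr_ge0 ?(ltW e0)//.
    by rewrite invr_ge0 mulr_ge0 ?(ltW gamma0) ?(ltW low0).
  by rewrite addr_ge0// mulr_ge0// ltW.
have [uz|uz0] := ltP 0 (u z); last first.
  by apply: le_trans rhs0; rewrite mulr_le0_ge0// exprn_ge0// ltW.
have [xh [d [/andP[d0 dr] U0 xhd uzd hU]]] := weighted_max z r eta r0 eta01 uz.
apply: le_trans uzd _.
set U := u xh in U0 hU *.
pose th := eta / (2 * N%:R); pose rr := th * d.
have N1 : 1 <= N%:R :> R by rewrite ler1n.
have th0 : 0 < th by rewrite divr_gt0// mulr_gt0.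
have th1 : th <= 1 by rewrite ler_pdivrMr ?mulr_gt0//; lra.
have the : th <= eta.
  rewrite ler_pdivrMr ?mulr_gt0//.
  have : eta * 1 <= eta * (2 * N%:R) by apply: ler_wpM2l; [exact: ltW|lra].
  by rewrite mulr1.
have rr0 : 0 < rr by rewrite mulr_gt0.
have rrd : rr <= d by rewrite ler_piMl// ltW.
have eU0 : 0 < eta * U by rewrite mulr_gt0.
have [y yB|x0 [x0x hval hmax]] := paraboloid_contact u xh rr (eta * U) cu rr0 eU0.
  by have := hU y yB; rewrite -/U; lra.
set A := 4 * (eta * U) / rr ^+ 2 in hval hmax; rewrite -/U in hval.
pose rho := rr / 2.
have rho0 : 0 < rho by rewrite divr_gt0.
have AE : A = eta * U / rho ^+ 2.
  by rewrite /A /rho; field; rewrite gt_eqF.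
have A0 : 0 < A by rewrite AE divr_gt0// exprn_gt0.
have bx y : eball x0 rho y -> enorm (y - xh) < rr.
  by apply: (eball_sub xh x0 rr rho); rewrite /rho; lra.
have bz y : eball x0 rho y -> eball z r y.
  move=> /bx yx; rewrite /eball/=; apply: le_lt_trans (enorm_triangle xh _ _) _; lra.
have Ox0 : Omega x0 by apply/zO/bz; exact: eball_center.
have UU : U <= u x0 by have := sqr_ge0 (enorm (x0 - xh)); move=> /(mulr_ge0 (ltW A0)); lra.
have x0M : u x0 <= 2 * U.
  have : u x0 <= (1 + eta) * U.
    by apply: hU; rewrite -/th -/rr; lra.
  have : eta * U <= 1 * U by rewrite ler_wpM2r// ltW.
  lra.
pose phi := paraboloid A xh x0 rho.
have phiE y : eball x0 rho y -> phi y = A * enorm (y - xh) ^+ 2 by exact: paraboloidE.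
have htest := hsub x0 Ox0 rho phi
  (test_paraboloid A xh x0 rho rho0 (fun y yb => zO y (bz y yb))).
have {htest} : ((f x0)%:E <= test_value K g c u rho phi x0)%E.
  apply: htest => y yb; rewrite (phiE y yb) (phiE x0 (eball_center _ _ rho0)).
  by apply: hmax; rewrite /cball/= ltW// bx.
have low := lower_order_le A xh x0 rho (2 * U) rho0 Ox0 x0M.
have fx := fM x0 Ox0.
rewrite /test_value; set t := g x0 _ + _ in low *.
pose P := rho `^ (- (2 * s)).
have P0 : 0 < P by exact: powR_gt0.
have rhoe : rho <= eta.
  rewrite /rho /rr; have : th * d <= eta * 1 
    by apply: ler_pM; [exact: ltW|exact: ltW|exact: the|exact: le_trans dr rle1].
  lra.
have rho1 : rho <= 1 by apply: le_trans e1.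
(* The gradient term scales like [rho^-1]; it is dominated because [1 <= 2 * s]
   and [rho <= 1]. *)
have Pinv : rho^-1 <= P.
  rewrite -(powR_inv1 (ltW rho0)); apply: ger_powR; first by rewrite rho0.
  by case/andP: hs; lra.
have P1 : 1 <= eta * P.
  apply: le_trans (_ : eta * rho^-1 <= _); last by rewrite ler_wpM2l// ltW.
  by rewrite ler_pdivlMr// mul1r.
have rho2 : rho `^ (2 - 2 * s) = rho ^+ 2 * P.
  by rewrite -powR_mulrn ?(ltW rho0)// -powRD// (gt_eqF rho0) implybT.
have hfar j := far_le_of_tail _ _ _ _ gamma0 gG s01 (hK i j) u x0 rho
  (kern rho * S0) N0 cu u0 rho0
  (integral_recentre_tail x0 x1 rho r1 D T ltac:(rewrite rho0//) r101 D0 (xD _ (bz _ (eball_center _ _ rho0))) hT).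
have Fb j : (LK (K i j) (eball x0 rho) phi x0 + LK (K i j) (~` eball x0 rho) u x0 <=
   (A * (Gamma * (near_cst * rho `^ (2 - 2 * s))) +
    (Gamma * (kern rho * S0) - gamma * (u x0 * (low_cst * P))))%:E)%E.
  have [m [/andP[_ mE] ->]] := LK_paraboloid _ _ _ _ x0 gamma0 gG s01 (hK i j) A xh rho rho0.
  rewrite LK_far// [leRHS]EFinD; apply: leeD; last exact: hfar.
  by rewrite lee_fin ler_wpM2l// ltW.
move=> /(le_infsup_bound _ _ _ _ i) /(_ Fb) main.
have t1 : t <= 2 * M1 * (eta * U) * P + 2 * c0 * (eta * U) * P.
  apply: le_trans (ler_norm _) _; apply: le_trans low _; apply: lerD.
    rewrite (gtr0_norm A0).
    apply: (@le_trans _ _ (M1 * (2 * A * rho))).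
      apply: ler_wpM2l => //; apply: ler_wpM2l; last exact: x0x.
      by rewrite mulr_ge0// ltW.
    have -> : M1 * (2 * A * rho) = 2 * M1 * (eta * U) * rho^-1.
      by rewrite AE; field; rewrite gt_eqF.
    by rewrite ler_wpM2l// !mulr_ge0 ?(ltW e0) ?(ltW U0).
  have -> : c0 * (2 * U) = 2 * c0 * U * 1 by ring.
  have -> : 2 * c0 * (eta * U) * P = 2 * c0 * U * (eta * P) by ring.
  by rewrite ler_wpM2l// !mulr_ge0 ?(ltW U0).
have A1 : A * (Gamma * (near_cst * rho `^ (2 - 2 * s))) = Gamma * near_cst * (eta * U) * P.
  by rewrite rho2 AE; field; rewrite gt_eqF.
have UP0 : 0 <= U * P by rewrite mulr_ge0// ltW.
have key : gamma * low_cst * (U * P) <= M + Gamma * (kern rho * S0) +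
    gamma * low_cst / 2 * (U * P).
  have h1 : gamma * low_cst * (U * P) <= gamma * (u x0 * (low_cst * P)).
    have -> : gamma * (u x0 * (low_cst * P)) = gamma * low_cst * (u x0 * P) by ring.
    by rewrite ler_wpM2l ?mulr_ge0 ?(ltW gamma0) ?(ltW low0)// ler_wpM2r// ltW.
  have h2 : Gamma * near_cst * (eta * U) * P + (2 * M1 * (eta * U) * P + 2 * c0 * (eta * U) * P)
      <= gamma * low_cst / 2 * (U * P).
    have -> : Gamma * near_cst * (eta * U) * P + (2 * M1 * (eta * U) * P + 2 * c0 * (eta * U) * P)
      = eta * (Gamma * near_cst + 2 * M1 + 2 * c0) * (U * P) by ring.
    by rewrite ler_wpM2r.
  have h3 : - M <= f x0 by move: fx; rewrite ler_norml => /andP[].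
  move: main; rewrite A1; lra.
(* Dividing by [kern rho], which is at least one and equals [P / rho ^+ N],
   turns [U * P] into [U * rho ^+ N]. *)
have kr1 : 1 <= kern rho.
  have <- : kern 1 = 1 by rewrite /kern powR1.
  exact: (kern_anti _ s01).
have Pk : P = rho ^+ N * kern rho by rewrite exprn_kern.
have kr0 : 0 < kern rho by exact: kern_gt0.
have fin : gamma * low_cst / 2 * (U * rho ^+ N) <= M + Gamma * S0.
  rewrite -(ler_pM2r kr0).
  have -> : gamma * low_cst / 2 * (U * rho ^+ N) * kern rho = gamma * low_cst / 2 * (U * P).
    by rewrite Pk; ring.
  have : M <= M * kern rho by rewrite ler_peMr.
  have -> : (M + Gamma * S0) * kern rho = M * kern rho + Gamma * (kern rho * S0) by ring.
  lra.
have -> : U * d ^+ N = (4 * N%:R / eta) ^+ N * (U * rho ^+ N).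
  rewrite mulrCA -exprMn; congr (_ * _ ^+ _); rewrite /rho /rr /th; field.
  by rewrite !gt_eqF.
rewrite ler_wpM2l ?exprn_ge0 ?divr_ge0 ?mulr_ge0 ?(ltW e0)//.
have gl0 : 0 < gamma * low_cst / 2 by rewrite divr_gt0// mulr_gt0.
rewrite -(ler_pM2l gl0); apply: le_trans fin _.
rewrite -/S0 le_eqVlt; apply/orP; left; apply/eqP; field.
by rewrite !gt_eqF.
Qed.

End HarnackSteps.

(** * Harnack's inequality *)

Section Assembly.
Context {R : realType} {N : nat}.
Local Notation V := 'rV[R]_N.

(** The property of being centre of a ball inside [D] holds near each point of
    the compact set, uniformly in small radii. *)
Lemma compactly_contained_radius (E D : set V) : open D -> compactly_contained E D ->
  exists r, 0 < r <= 1 /\ forall z, E z -> eball z r `<=` D.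
Proof.
move=> oD [cE ED].
have : \forall e \near (0 : R)^'+, forall x, closure E x -> eball x e `<=` D.
  move/compact_near_coveringP : cE => nc.
  apply: (nc _ (0^'+ : set_system R) (fun e x => eball x e `<=` D)) => x Ex.
  have /nbhs_ballP[d /= d0 xD] : nbhs x D by apply: open_nbhs_nbhs; split => //; exact: ED.
  exists (eball x (d / 2), [set e : R | e < d / 2]).
    split; first by apply: nbhs_eball; rewrite /eball/= subrr enorm0 divr_gt0.
    by apply: nbhs_right_lt; rewrite divr_gt0.
  move=> [y e] [/= yx ed] w wy; apply: xD; apply: ball_rV_coord => // i.
  have := coord_le_enorm (w - x) i; rewrite !mxE distrC => /le_lt_trans; apply.
  have -> : d = d / 2 + d / 2 by field.
  apply: le_lt_trans (enorm_triangle y _ _) _; apply: ltrD => //.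
  exact: lt_trans wy ed.
move=> H; near (0 : R)^'+ => e.
have e0 : 0 < e by near: e; exact: nbhs_right_gt.
exists (Num.min e 1); split; first by rewrite lt_min e0 ltr01 ge_min lexx orbT.
move=> z Ez y yz; have : eball z e `<=` D.
  by move: {y yz} z Ez; near: e; apply: filterS H => e H z /subset_closure; exact: H.
apply; apply: lt_le_trans yz _; by rewrite ge_min lexx.
Unshelve. all: by end_near. Qed.

Lemma bounded_set_diameter (D : set V) : bounded_set D ->
  exists d, 0 <= d /\ forall x y, D x -> D y -> enorm (x - y) <= d.
Proof.
move=> /ex_strict_bound_gt0[B B0 hB]; exists (N%:R * (B + B)).
have B1 : 0 <= B + B by rewrite addr_ge0// ltW.
split; first by rewrite mulr_ge0.
move=> x y Dx Dy; apply: enorm_le_coord => // i.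
have coord (w : V) : D w -> `|w ord0 i| <= B.
  move=> /hB /ltW; apply: le_trans; rewrite [leRHS]mx_normrE.
  exact: (le_bigmax _ (fun j : 'I_1 * 'I_N => `|w j.1 j.2|) (ord0, i)).
by rewrite !mxE; apply: le_trans (ler_normB _ _) _; apply: lerD; exact: coord.
Qed.

End Assembly.

Section Harnack.
Context {R : realType} {N : nat}.
Local Notation V := 'rV[R]_N.
Variables (gamma Gamma s : R) (I J : Type) (K : I -> J -> V -> R).
Variables (Omega Omega' : set V) (c : V -> R) (g : V -> V -> R) (M1 c0 : R).
Hypotheses (N0 : (0 < N)%N) (gamma0 : 0 < gamma) (gG : gamma <= Gamma).
Hypothesis hs : 1 / 2 < s < 1.
Hypothesis hK : forall i j, kernel_class gamma Gamma s (K i j).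
Hypotheses (M10 : 0 <= M1) (c00 : 0 <= c0).
Hypothesis hc : forall x, Omega x -> `|c x| <= c0.
Hypothesis hg : forall x p, Omega x -> `|g x p| <= M1 * enorm p.
Hypotheses (hOmega : bounded_domain Omega) (hOmega' : compactly_contained Omega' Omega).

(** Stated with a positive bound [M] on both data, since a paraboloid of positive
    opening is needed even where [u] and [f] vanish; the theorem takes the
    infimum over [M]. *)
Lemma harnack_pointwise : exists2 C : R, 0 <= C & forall (f u : V -> R) (M : R) (z z' : V),
  (forall x, 0 <= u x) -> viscosity_solution K g c f Omega u ->
  0 < M -> (forall x, Omega x -> `|f x| <= M) -> Omega' z -> Omega' z' -> u z' <= M ->
  u z <= C * M.
Proof.
have [oO _ _ bO] := hOmega.
have [r [r01 hr]] := compactly_contained_radius Omega' Omega oO hOmega'.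
have [D [D0 hD]] := bounded_set_diameter Omega bO.
have /andP[r0 r1] := r01.
have G0 := lt_le_trans gamma0 gG.
have s01' := s01 s hs.
have NR : 0 < N%:R :> R by rewrite ltr0n.
have low0 : 0 < low_cst (N := N) s by apply: kern_gt0; rewrite mulr_gt0.
have near0 := near_cst_ge0 (N := N) s s01'.
set low := low_cst s in low0; set near := near_cst s in near0.
pose E := Gamma * near + 2 * M1 + 2 * c0.
have E0 : 0 <= E by apply: addr_ge0; [apply: addr_ge0|]; rewrite mulr_ge0// ltW.
pose eta := Num.min 1 (gamma * low / 2 / (E + 1)).
have E1 : 0 < E + 1 by lra.
have gl0 : 0 < gamma * low by rewrite mulr_gt0.
have eta01 : 0 < eta <= 1.
  by rewrite /eta lt_min ltr01/= divr_gt0 ?divr_gt0//= ge_min lexx.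
have heta : eta * E <= gamma * low / 2.
  have h1 : eta <= gamma * low / 2 / (E + 1) by rewrite /eta ge_min lexx orbT.
  have h2 : eta * (E + 1) <= gamma * low / 2 by rewrite -ler_pdivlMr.
  have /andP[e0 _] := eta01; lra.
pose Ct := tail_total (N := N) gamma Gamma s M1 c0 r.
have Ct0 : 0 <= Ct by apply: tail_total_ge0.
pose Cs := (4 * N%:R / eta) ^+ N *
  (2 / (gamma * low) * (1 + Gamma * (kern (N := N) s (1 + D)^-1 * (Ct / gamma)))).
have Cs0 : 0 <= Cs.
  have /andP[e0 _] := eta01.
  apply: mulr_ge0; first by rewrite exprn_ge0// divr_ge0 ?mulr_ge0 ?(ltW e0).
  apply: mulr_ge0; first by rewrite divr_ge0// ltW.
  apply: addr_ge0 => //; apply: mulr_ge0; first exact: ltW.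
  by apply: mulr_ge0; [exact: kern_ge0|rewrite divr_ge0// ltW].
exists (Cs / r ^+ N); first by rewrite divr_ge0// exprn_ge0// ltW.
move=> f u M z z' u0 [hsub hsup] M0 fM Oz Oz' uz'.
have cu : continuous u by apply: semicontinuous_continuous; [exact: hsub.1|exact: hsup.1].
have hJ := subsolution_inhabited I J K Omega c f u g cu z r r0 (hr z Oz) hsub.
have [x1 [x1z [i] tail]] := supersolution_tail gamma Gamma s I J K Omega c f u g M1 c0
  N0 gamma0 gG hs hK M10 hc hg cu u0 z' r M r01 (hr z' Oz') M0 uz' fM hJ hsup.
have r201 : 0 < r / 2 <= 1 by apply/andP; split; lra.
have xD x : eball z r x -> enorm (x - x1) <= D.
  by move=> /(hr z Oz) Ox; apply: hD => //; exact: (hr z' Oz').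
have T0 : 0 <= Ct * M by rewrite mulr_ge0// ltW.
have := subsolution_bound gamma Gamma s I J K Omega c f u g M1 c0
  N0 gamma0 gG hs hK M10 c00 hc hg cu u0 z x1 r (r / 2) M (Ct * M) D eta i
  r01 (hr z Oz) (ltW M0) fM hsub r201 D0 xD T0 tail eta01 heta.
have rN0 : 0 < r ^+ N by rewrite exprn_gt0.
rewrite -ler_pdivlMr// => /le_trans; apply.
rewrite /Cs -/low; move: ((4 * N%:R / eta) ^+ N) (r ^+ N) rN0 => X Y Y0.
rewrite le_eqVlt; apply/orP; left; apply/eqP; field.
by rewrite !gt_eqF.
Qed.

End Harnack.

Theorem theorem1p2 (R : realType) (N : nat) (hN : (0 < N)%N)
  (gamma Gamma : R) (hgamma : 0 < gamma) (hGamma : gamma <= Gamma)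
  (s : R) (hs : 1 / 2 < s < 1)
  (I J : metricType R) (cI : compact [set: I]) (cJ : compact [set: J])
  (K : I -> J -> 'rV[R]_N -> R)
  (hK : forall i j, kernel_class gamma Gamma s (K i j))
  (Omega : set 'rV[R]_N) (hOmega : bounded_domain Omega)
  (c : 'rV[R]_N -> R) (hc : Linfty Omega c)
  (g : 'rV[R]_N -> 'rV[R]_N -> R) (M1 : R)
  (hg : forall x p, Omega x -> `|g x p| <= M1 * enorm p)
  (Omega' : set 'rV[R]_N) (hOmega' : compactly_contained Omega' Omega) :
  exists C : R, forall f u : 'rV[R]_N -> R,
    Linfty Omega f ->
    (forall x, 0 <= u x) ->
    viscosity_solution K g c f Omega u ->
    (ereal_sup [set (u x)%:E | x in Omega'] <=
     C%:E * (ereal_inf [set (u x)%:E | x in Omega'] + Linfty_norm Omega f))%E.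
Proof.
have [_ [c0 hc0]] := hc.
have hc' x : Omega x -> `|c x| <= `|c0| by move=> /hc0 /le_trans; apply; exact: ler_norm.
have hg' x p : Omega x -> `|g x p| <= `|M1| * enorm p.
  by move=> /hg /le_trans; apply; rewrite ler_wpM2r ?enorm_ge0// ler_norm.
have [C C0 hC] := harnack_pointwise gamma Gamma s I J K Omega Omega' c g `|M1| `|c0|
  hN hgamma hGamma hs hK (normr_ge0 _) (normr_ge0 _) hc' hg' hOmega hOmega'.
exists C => f u [_ [F0 hF0]] u0 sol.
have [->|/set0P[z' Oz']] := eqVneq Omega' set0.
  by rewrite !image_set0 ereal_sup0 leNye.
have [_ _ [w Ow] _] := hOmega.
have [F [FE hF]] : exists F : R, Linfty_norm Omega f = F%:E /\
    forall x, Omega x -> `|f x| <= F.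
  have ub x : Omega x -> ((`|f x|)%:E <= Linfty_norm Omega f)%E.
    by move=> Ox; apply: ereal_sup_ubound; exists x.
  have bd : (Linfty_norm Omega f <= F0%:E)%E.
    by apply: ge_ereal_sup => _ [x Ox <-]; rewrite lee_fin hF0.
  move: ub bd; case: (Linfty_norm Omega f) => [F| |] ub bd.
  - by exists F; split => // x /ub; rewrite lee_fin.
  - by move: bd; rewrite leye_eq.
  - by have := ub w Ow; rewrite leeNy_eq.
have F_ge0 : 0 <= F by apply: le_trans (hF w Ow).
have [m [mE m0]] : exists m : R,
    ereal_inf [set (u x)%:E | x in Omega'] = m%:E /\ 0 <= m.
  have lb : (0%:E <= ereal_inf [set (u x)%:E | x in Omega'])%E.
    by apply: le_ereal_inf_tmp => _ [x _ <-]; rewrite lee_fin.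
  have ub : (ereal_inf [set (u x)%:E | x in Omega'] <= (u z')%:E)%E.
    by apply: ereal_inf_lbound; exists z'.
  move: lb ub; case: (ereal_inf _) => [m| |] lb ub.
  - by exists m; split => //; rewrite -lee_fin.
  - by move: ub; rewrite leye_eq.
  - by move: lb; rewrite leeNy_eq.
rewrite mE FE -EFinD -EFinM; apply: ge_ereal_sup => _ [z Oz <-]; rewrite lee_fin.
(* The infimum need not be attained. *)
apply/ler_addgt0Pr => e e0.
have d0 : 0 < e / (C + 1) by rewrite divr_gt0//; lra.
have [_ [z1 Oz1 <-]] : exists2 t, [set (u x)%:E | x in Omega'] t & (t < (m + e / (C + 1))%:E)%E.
  by apply: ereal_inf_lt; rewrite mE lte_fin ltrDl.
rewrite lte_fin => uz1.
have := hC f u (m + F + e / (C + 1)) z z1 u0 sol.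
have h1 : 0 < m + F + e / (C + 1) by lra.
have h2 x : Omega x -> `|f x| <= m + F + e / (C + 1) by move=> /hF; lra.
have h3 : u z1 <= m + F + e / (C + 1) by lra.
move=> /(_ h1 h2 Oz Oz1 h3) /le_trans; apply.
rewrite mulrDr lerD2l mulrA ler_pdivrMr; last by lra.
by rewrite mulrC ler_wpM2l ?(ltW e0)//; lra.
Qed.
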